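(* Let $r, c \geq 1$, $n = rc$, and let $P, Q \in \mathrm{SYT}(r \times c)$. Let $S = \mathrm{stack}(P, Q) \in \mathrm{SYT}(2r \times c)$. Then the list $\big(\mathrm{prom}_r(S)(1) - n, \ldots, \mathrm{prom}_r(S)(n) - n\big)$ is the permutation of $\{1,\dots,n\}$ given by $$\big(\mathrm{prom}_r(S)(1) - n, \ldots, \mathrm{prom}_r(S)(n) - n\big) = \mathrm{RS}^{-1}(Q^\top, P^\top),$$ where $Q^\top, P^\top$ denote the transposes of $Q, P$.
   Context: $\mathrm{SYT}(R \times c)$ is the set of standard Young tableaux (English notation, rows increasing left to right, columns increasing top to bottom, entries $1,\dots,N$ with $N=Rc$) of rectangular shape with $R$ rows and $c$ columns. For $P, Q \in \mathrm{SYT}(r\times c)$ and $n=rc$, $\mathrm{stack}(P,Q) \in \mathrm{SYT}(2r \times c)$ is the tableau whose first $r$ rows are $P$ and whose last $r$ rows are $Q$ with $n$ added to every entry. Gromotion: for a filling $T$ of the $R\times c$ rectangle by distinct integers increasing along rows and columns, with smallest entry $m$, delete the cell containing $m$, then repeatedly move the empty cell by swapping it with the smaller of the entries immediately to its right and immediately below it (or the only one that exists) until the empty cell reaches the bottom-right corner; fill that corner with $m+N$. The result is $\mathrm{g}(T)$. Starting from $T \in \mathrm{SYT}(R\times c)$, the $j$-th application of gromotion (computing $\mathrm{g}^j(T)$ from $\mathrm{g}^{j-1}(T)$), $1 \le j \le N$, deletes the entry $j$; during it exactly one entry slides upward from row $i+1$ into row $i$, for each $1\le i\le R-1$. The $i$-th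 promotion permutation $\mathrm{prom}_i(T)$ ($1 \le i \le R-1$) is the list whose $j$-th term is the entry that slides from row $i+1$ into row $i$ during the $j$-th application of gromotion, reduced modulo $N$ to a residue in $\{1,\dots,N\}$; it is a permutation of $\{1, \dots, N\}$. $\mathrm{RS}$ denotes the Robinson–Schensted correspondence $\mathfrak{S}_n \to \bigsqcup_{\lambda\vdash n}\mathrm{SYT}(\lambda)\times\mathrm{SYT}(\lambda)$, $w \mapsto (\text{insertion tableau}, \text{recording tableau})$ obtained by row-inserting $w(1), w(2), \dots, w(n)$ in order. *)

(* Defs.v *)
From mathcomp Require Import all_boot.

Set Implicit Arguments.
Unset Strict Implicit.
Unset Printing Implicit Defensive.

(* A filling is the list of its rows, top to bottom (English notation).
   Rows, columns and cells are indexed from 0 here; promotion permutations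
   [prom i] and their positions are indexed from 1. *)
Definition tableau := seq (seq nat).

Definition entry (T : tableau) (p : nat * nat) : nat :=
  nth 0 (nth [::] T p.1) p.2.

Definition set_entry (T : tableau) (p : nat * nat) (x : nat) : tableau :=
  set_nth [::] T p.1 (set_nth 0 (nth [::] T p.1) p.2 x).

(* [c] is the number of columns of [T]. *)
Definition transpose (c : nat) (T : tableau) : tableau :=
  [seq [seq nth 0 row j | row <- T] | j <- iota 0 c].

Definition SYT (R c : nat) (T : tableau) : bool :=
  [&& shape T == nseq R c,
      all (sorted ltn) T,
      all (sorted ltn) (transpose c T) &
      perm_eq (flatten T) (iota 1 (R * c))].

Definition stack (n : nat) (P Q : tableau) : tableau :=
  P ++ [seq [seq x + n | x <- row] | row <- Q].

(* Where the empty cell, currently at [p], moves; it stays put once it is in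
   the bottom-right corner. *)
Definition next_cell (R c : nat) (T : tableau) (p : nat * nat) : nat * nat :=
  let: (i, j) := p in
  let below := (i.+1, j) in
  let right := (i, j.+1) in
  if i.+1 < R then
    if j.+1 < c then
      if entry T below < entry T right then below else right
    else below
  else if j.+1 < c then right else p.

(* A state is a filling together with the position of its empty cell; the
   value stored at that position is meaningless. *)
Definition slide_step (R c : nat) (s : tableau * (nat * nat)) :=
  let q := next_cell R c s.1 s.2 in (set_entry s.1 s.2 (entry s.1 q), q).

(* The successive states of one gromotion. In an increasing filling the
   smallest entry is in the top-left corner, and the empty cell reaches the
   bottom-right corner after exactly (R - 1) + (c - 1) moves. *)
Definition slide_states (R c : nat) (T : tableau) :
    seq (tableau * (nat * nat)) :=
  traject (slide_step R c) (T, (0, 0)) (R.-1 + c.-1).+1.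

Definition gromotion (R c : nat) (T : tableau) : tableau :=
  let m := entry T (0, 0) in
  let s := last (T, (0, 0)) (slide_states R c T) in
  set_entry s.1 (R.-1, c.-1) (m + R * c).

(* The entry sliding from the (i+1)-st into the i-th row (counted from 1)
   during the gromotion of [T], for 1 <= i < R: at the first state in which the
   empty cell is in the (i+1)-st row, it is the entry just above that cell. *)
Definition slid_up (R c i : nat) (T : tableau) : nat :=
  let sts := slide_states R c T in
  let s := nth (T, (0, 0)) sts (find (fun s => s.2.1 == i) sts) in
  entry s.1 (i.-1, s.2.2).

(* The representative in {1, ..., N} of the class of x >= 1 modulo N. *)
Definition residue1 (N x : nat) : nat := (x.-1 %% N).+1.

Definition prom (R c i : nat) (T : tableau) : seq nat :=
  [seq residue1 (R * c) (slid_up R c i (iter j.-1 (gromotion R c) T))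
     | j <- iota 1 (R * c)].

(* Row insertion of [x]; also returns the row index of the new cell. *)
Fixpoint row_insert (x : nat) (T : tableau) : tableau * nat :=
  if T is row :: T' then
    let k := find (fun y => x < y) row in
    if k < size row then
      let: (U, i) := row_insert (nth 0 row k) T' in
      (set_nth 0 row k x :: U, i.+1)
    else (rcons row x :: T', 0)
  else ([:: [:: x]], 0).

Definition RS_step (PQ : tableau * tableau) (xk : nat * nat) :
    tableau * tableau :=
  let: (U, i) := row_insert xk.1 PQ.1 in
  (U, set_nth [::] PQ.2 i (rcons (nth [::] PQ.2 i) xk.2)).

(* Permutations of {1, ..., n} are given in one-line notation. The result is
   the pair (insertion tableau, recording tableau). *)
Definition RS (w : seq nat) : tableau * tableau :=
  foldl RS_step ([::], [::]) (zip w (iota 1 (size w))).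

(* The permutation w of {1, ..., n} with RS w = PQ, which is unique since RS is
   injective on permutations; [::] if there is none. *)
Definition RS_inv (n : nat) (PQ : tableau * tableau) : seq nat :=
  head [::] [seq w <- permutations (iota 1 n) | RS w == PQ].

(* Main.v *)
(** Record a standard tableau by the list of the cells of its entries
    1, 2, 3, ...  A jeu de taquin slide then becomes a single left-to-right pass:
    a hole [h] meeting a cell [a] trades places with it exactly when [a] is
    immediately to the right of or below [h].

    In [stack P Q] the columns of [Q] move straight up during the first [n]
    gromotions: if the cells still filled by [P] have column heights [h_k], the
    entry of [Q] in column [k] and row [i] sits in row [h_k + i], and a hole
    leaving [P] at the bottom of column [k] prefers the entry below it all along
    that column.  Hence the entry crossing the middle line at time [j] is read
    off from the corner of [P] vacated at time [j].

    Evacuation of a rectangle is the 180 degree rotation: that corner is the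
    rotation of the cell of [j] in [P].  Indeed slides preserve elementary dual
    equivalences and vacate the same corner for dual equivalent fillings, and
    all fillings of the cells after time [j] are dual equivalent, so the shape
    left by [P] after [j] slides depends only on the shape of its entries
    [<= j].  If that shape can grow inside the rectangle in two ways, comparing
    them determines the answer by induction; otherwise descents, which slides
    preserve, do.

    Thus [w(j) = Q(i, c-1-k)] where [(i, k)] is the cell of [j] in [P].
    Row insertion of this word into the transposed tableau always bumps straight
    down a single column, whence [RS w = (Q^T, P^T)]. *)

Require Import Defs.
From mathcomp Require Import all_boot zify.

Set Implicit Arguments.
Unset Strict Implicit.
Unset Printing Implicit Defensive.

(** * Tableaux as growing lists of cells *)

Definition cell := (nat * nat)%type.
Definition rt (x : cell) : cell := (x.1, x.2.+1).
Definition dn (x : cell) : cell := (x.1.+1, x.2).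
Definition adj (h a : cell) := (a == rt h) || (a == dn h).

Definition addable (D : seq cell) (x : cell) :=
  [&& x \notin D, (x.1 == 0) || ((x.1.-1, x.2) \in D)
    & (x.2 == 0) || ((x.1, x.2.-1) \in D)].

(* [s] lists the cells of a standard filling of a skew shape with inner shape [D],
   in the order of their entries. *)
Fixpoint valid (D s : seq cell) :=
  if s is x :: s' then addable D x && valid (x :: D) s' else true.

(** Young diagrams, as order ideals of the quadrant. *)
Definition ideal (D : seq cell) :=
  forall x, x \in D -> forall y : cell, y.1 <= x.1 -> y.2 <= x.2 -> y \in D.

Lemma eq_addable D D' : D =i D' -> addable D =1 addable D'.
Proof. by move=> e x; rewrite /addable !e. Qed.

Lemma eq_valid D D' s : D =i D' -> valid D s = valid D' s.
Proof.
elim: s D D' => //= x s IH D D' e.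
rewrite (eq_addable e); congr andb; apply: IH => y.
by rewrite !inE e.
Qed.

Lemma valid_cat D s1 s2 : valid D (s1 ++ s2) = valid D s1 && valid (s1 ++ D) s2.
Proof.
elim: s1 D => //= x s1 IH D; rewrite IH andbA; congr andb.
by apply: eq_valid => y; rewrite !(inE, mem_cat); do !case: (_ \in _); rewrite ?orbT.
Qed.

Lemma ideal0 : ideal [::]. Proof. by []. Qed.

Lemma addable_ideal D x : ideal D -> addable D x -> ideal (x :: D).
Proof.
move=> iD /and3P[nx ux lx] z; rewrite inE => /orP[/eqP-> y y1 y2|zD y y1 y2]; last first.
  by rewrite inE (iD z) ?orbT.
rewrite inE; case: eqP => //= ne.
have [lt1|le1] := ltnP y.1 x.1.
  by apply: (iD (x.1.-1, x.2) _ y _ y2) => /=; [case/orP: ux => [/eqP e|//] |]; lia.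
have lt2 : y.2 < x.2.
  by case: (ltnP y.2 x.2) => // le2; case: ne; case: (x) (y) y1 y2 le1 le2 => a b [a' b'] /= *; congr pair; lia.
by apply: (iD (x.1, x.2.-1) _ y y1) => /=; [case/orP: lx => [/eqP e|//] |]; lia.
Qed.

Lemma valid_ideal D s : ideal D -> valid D s -> ideal (s ++ D).
Proof.
elim: s D => //= x s IH D iD /andP[ax vs].
have := IH _ (addable_ideal iD ax) vs => H z zD y y1 y2.
have zD' : z \in s ++ x :: D by move: zD; rewrite !(inE, mem_cat); do !case: (_ \in _); rewrite ?orbT.
by have := H _ zD' y y1 y2; rewrite !(inE, mem_cat); do !case: (_ \in _); rewrite ?orbT.
Qed.

Lemma valid0_ideal s : valid [::] s -> ideal s.
Proof. by move/(valid_ideal ideal0); rewrite cats0. Qed.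

Lemma valid_uniq D s : valid D s -> uniq s && all (fun x => x \notin D) s.
Proof.
elim: s D => //= x s IH D /andP[/and3P[nx _ _] /IH/andP[-> al]].
rewrite nx /= andbT; apply/andP; split.
  by apply/negP => xs; move/allP/(_ _ xs): al; rewrite inE eqxx.
by apply/allP => y /(allP al); rewrite inE negb_or => /andP[].
Qed.

Lemma valid0_uniq s : valid [::] s -> uniq s.
Proof. by case/valid_uniq/andP. Qed.

Definition rel_pos (x y : cell) :=
  [|| adj x y, (y.1 < x.1) && (x.2 < y.2) | (x.1 < y.1) && (y.2 < x.2)].

(** [y] cannot be weakly north-west of [x], since [x :: D] is an ideal. If it is weakly south-east,
    its upper or left neighbour lies in [x :: D] and dominates [x], hence is [x] itself because [D]
    is an ideal without [x]. *)
Lemma valid_rel_pos D x y s : ideal D -> valid D [:: x, y & s] -> rel_pos x y.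
Proof.
move=> iD /= /and3P[/and3P[nx ux lx] /and3P[ny uy ly] _].
move: ny; rewrite inE negb_or => /andP[nyx ny].
have iDx : ideal (x :: D) by apply: addable_ideal => //; apply/and3P.
have lexy : ~ (y.1 <= x.1 /\ y.2 <= x.2).
  case=> y1 y2; have := iDx x (mem_head _ _) y y1 y2.
  by rewrite inE (negPf nyx) (negPf ny).
have H z : z \in x :: D -> x.1 <= z.1 -> x.2 <= z.2 -> z = x.
  by rewrite inE => /orP[/eqP//|zD z1 z2]; move: nx; rewrite (iD z).
rewrite /rel_pos /adj; case: (ltnP x.1 y.1) => l1; case: (ltnP x.2 y.2) => l2.
- have /= := H (y.1.-1, y.2); case/orP: uy => [/eqP e|-> /(_ isT) K]; first by rewrite e in l1.
  have {}K : (y.1.-1, y.2) = x by apply: K; lia.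
  by move: l2; rewrite -K /= ltnn.
- case: (ltnP y.2 x.2) => l3; first by rewrite ?orbT ?andbT; lia.
  have /= := H (y.1.-1, y.2); case/orP: uy => [/eqP e|-> /(_ isT) K]; first by rewrite e in l1.
  have {}K : (y.1.-1, y.2) = x by apply: K; lia.
  by rewrite -K /dn /= prednK ?(leq_ltn_trans _ l1) // -surjective_pairing eqxx orbT.
- case: (ltnP y.1 x.1) => l3; first by rewrite /= ?orbT.
  have /= := H (y.1, y.2.-1); case/orP: ly => [/eqP e|-> /(_ isT) K]; first by rewrite e in l2.
  have {}K : (y.1, y.2.-1) = x by apply: K; lia.
  by rewrite -K /rt /= prednK ?(leq_ltn_trans _ l2) // -surjective_pairing eqxx.
- by case: lexy.
Qed.

Lemma adj_le x y : adj x y -> (x.1 <= y.1) && (x.2 <= y.2).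
Proof. by case/orP => /eqP -> /=; rewrite ?leqnn ?leqnSn. Qed.

Lemma adj_neq x y : adj x y -> y != x.
Proof. by case: x y => a b [a' b'] /orP[]/eqP[-> ->]; rewrite xpair_eqE; lia. Qed.

(** Adding [x] first can only help [y] when [x] is its upper or left neighbour. *)
Lemma valid_swap D x y s : valid D [:: x, y & s] -> ~~ adj x y -> valid D [:: y, x & s].
Proof.
move=> /= /and3P[/and3P[nx ux lx] /and3P[ny uy ly] vs] na.
move: ny; rewrite inE negb_or => /andP[nyx ny].
rewrite (@eq_valid _ [:: x, y & D]) in vs; last first.
  by move=> z; rewrite !inE; do !case: (_ == _).
rewrite vs andbT /addable ny !inE negb_or (eq_sym x) nyx nx /=.
apply/andP; split; apply/andP; split.
- move: uy; rewrite inE; case/or3P => [->//|/eqP e|->]; last by rewrite orbT.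
  case: eqP => //= y0; case/negP: na; rewrite /adj -e /dn /= prednK; last lia.
  by rewrite -surjective_pairing eqxx orbT.
- move: ly; rewrite inE; case/or3P => [->//|/eqP e|->]; last by rewrite orbT.
  case: eqP => //= y0; case/negP: na; rewrite /adj -e /rt /= prednK; last lia.
  by rewrite -surjective_pairing eqxx.
- by case/orP: ux => ->; rewrite ?orbT.
- by case/orP: lx => ->; rewrite ?orbT.
Qed.

(** The diagonal cell would need both the right and the lower neighbour of [x] before it, but only
    [y] comes in between. *)
Lemma valid_diag D x y z s : ideal D -> valid D [:: x, y, z & s] ->
  z != (x.1.+1, x.2.+1).
Proof.
move=> iD /= /and4P[ax ay /and3P[nz uz lz] _]; apply/eqP => e.
move: uz lz; rewrite e /= !inE.
have nx : x \notin D by case/and3P: ax.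
have nD p : p \in D -> x.1 <= p.1 -> x.2 <= p.2 -> False.
  by move=> pD p1 p2; move: nx; rewrite (iD p).
case/or3P => [/eqP u|/eqP u|/nD]; last 1 first.
  by move/(_ (leqnn _) (leqnSn _)).
- case/or3P => [/eqP v|/eqP v|/nD]; last 1 first.
  + by move/(_ (leqnSn _) (leqnn _)).
  + by move: v; rewrite -u; case=> /eqP; rewrite -(inj_eq succn_inj); lia.
  + by move/(congr1 fst): v => /=; lia.
- by move/(congr1 snd): u => /=; lia.
Qed.

(** * Sliding a hole *)

(* The hole [h] slides through the cells [s] of the remaining entries, visited in
   increasing order: [outs] lists their new cells, [hole] is where the hole ends. *)
Fixpoint outs (h : cell) (s : seq cell) : seq cell :=
  if s is a :: s' then
    if adj h a then h :: outs a s' else a :: outs h s'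
  else [::].

Fixpoint hole (h : cell) (s : seq cell) : cell :=
  if s is a :: s' then hole (if adj h a then a else h) s' else h.

Lemma size_outs h s : size (outs h s) = size s.
Proof. by elim: s h => //= a s IH h; case: ifP => _ /=; rewrite IH. Qed.

Lemma hole_cat h s1 s2 : hole h (s1 ++ s2) = hole (hole h s1) s2.
Proof. by elim: s1 h => /=. Qed.

Lemma outs_cat h s1 s2 : outs h (s1 ++ s2) = outs h s1 ++ outs (hole h s1) s2.
Proof. by elim: s1 h => //= a s IH h; case: ifP => _ /=; rewrite IH. Qed.

(** The hole travels along as one more cell of the list: either it settles and [a] becomes the hole,
    or [valid_swap] carries it past [a]. *)
Lemma slide_valid D h s :
  valid D (h :: s) -> valid D (rcons (outs h s) (hole h s)).
Proof.
elim: s D h => //= a s IH D h /and3P[ah aa vs].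
case: ifP => na.
  by rewrite /= ah; apply: IH; rewrite /= aa.
have /= := @valid_swap D h a s; rewrite ah aa vs na => /(_ isT isT) /and3P[-> b c].
by apply: IH; rewrite /= b.
Qed.

Lemma slide_perm h s : perm_eq (rcons (outs h s) (hole h s)) (h :: s).
Proof.
elim: s h => //= a s IH h; case: ifP => na /=.
  by rewrite perm_cons.
apply: (@perm_trans _ (a :: h :: s)); first by rewrite perm_cons.
by rewrite -[X in perm_eq X _]/([:: a] ++ [:: h] ++ s) perm_catCA.
Qed.

(* The content of a cell is its column minus its row. *)
Definition content_lt (x y : cell) := x.2 + y.1 < y.2 + x.1.
Definition content_btw (x y z : cell) := content_lt x y && content_lt y z || content_lt z y && content_lt y x.

(* Haiman's elementary dual equivalences on three consecutive entries. *)
Definition dual_move (x y z x' y' z' : cell) :=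
  [&& x' == y, y' == x, z' == z & content_btw x z y] ||
  [&& x' == x, y' == z, z' == y & content_btw y x z].

Definition not_diag (x z : cell) := z != (x.1.+1, x.2.+1).

Lemma valid_tail D x s : ideal D -> valid D (x :: s) -> ideal (x :: D) /\ valid (x :: D) s.
Proof. by move=> iD /= /andP[/(addable_ideal iD)]. Qed.

Lemma chain3 D x y z s : ideal D -> valid D [:: x, y, z & s] ->
  [/\ rel_pos x y, rel_pos y z & not_diag x z].
Proof.
move=> iD v; split.
- exact: valid_rel_pos v.
- by case: (valid_tail iD v) => i v'; apply: valid_rel_pos v'.
- exact: valid_diag v.
Qed.

(** Contents at distance at least 2: replacing one of the cells by a neighbour, which shifts its
    content by 1, cannot reverse the order. *)
Definition far (x y : cell) :=
  ((x.2 + y.1).+1 < y.2 + x.1) || ((y.2 + x.1).+1 < x.2 + y.1).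

Lemma rel_pos_far x y : rel_pos x y -> adj x y = false -> far x y.
Proof. by rewrite /rel_pos => /orP[->//|]; case: x y => x1 x2 [y1 y2] + _; rewrite /far /=; lia. Qed.

Lemma farC x y : far x y = far y x.
Proof. by rewrite /far orbC. Qed.

Ltac contents := rewrite /content_btw /content_lt /far /=; lia.

Lemma content_lt_adj_far h x y : adj h x -> far x y -> content_lt h y = content_lt x y.
Proof. by case: h x y => h1 h2 [x1 x2] [y1 y2] /orP[]/eqP[-> ->]; contents. Qed.

Lemma content_lt_far_adj h x y : adj h y -> far h x -> content_lt x h = content_lt x y.
Proof. by case: h x y => h1 h2 [x1 x2] [y1 y2] /orP[]/eqP[-> ->]; contents. Qed.

(** Two unit steps that miss the diagonal cell go in the same direction. *)
Lemma content_lt_adj_adj h x y : adj h x -> adj x y -> not_diag h y -> content_lt h x = content_lt x y.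
Proof.
case: h x y => h1 h2 [x1 x2] [y1 y2] /orP[]/eqP[-> ->] /orP[]/eqP[-> ->];
  by rewrite /not_diag ?eqxx //= => _; contents.
Qed.

(** For consecutive entries the comparison of contents records whether there is a descent; this is
    the local form of the invariance of descents under slides. *)
Lemma slide2_content_lt D h x y : ideal D -> valid D [:: h; x; y] ->
  forall o1 o2, outs h [:: x; y] = [:: o1; o2] -> content_lt o1 o2 = content_lt x y.
Proof.
move=> iD v o1 o2; have [s1 s2 d1] := chain3 iD v.
rewrite /=; case a1: (adj h x).
  case a2: (adj x y) => -[<- <-]; first exact: content_lt_adj_adj.
  exact: content_lt_adj_far a1 (rel_pos_far s2 a2).
by case a2: (adj h y) => -[<- <-] //; apply: content_lt_far_adj a2 (rel_pos_far s1 a1).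
Qed.

Lemma valid_cons D x s : valid D (x :: s) = addable D x && valid (x :: D) s.
Proof. by []. Qed.

Lemma valid_swap2 D x y z s : valid D [:: x, y, z & s] -> ~~ adj y z -> valid D [:: x, z, y & s].
Proof.
by rewrite !(valid_cons D) => /andP[-> v] na; apply: valid_swap v na.
Qed.

(* Two successive slides, with holes [h2] after [h1], both passing the cell [a]. *)
Lemma slide2_hole D h2 h1 a : ideal D -> valid D [:: h2; h1; a] ->
  forall o h1', (if adj h1 a then (h1, a) else (a, h1)) = (o, h1') ->
  content_lt (if adj h2 o then o else h2) h1' = content_lt h2 h1.
Proof.
move=> iD v o h1'; have [s1 s2 d1] := chain3 iD v.
case a1: (adj h1 a) => -[<- <-]{o h1'}; case: ifP => a2 //.
- by rewrite (content_lt_adj_adj a2 a1 d1).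
- by rewrite -(content_lt_far_adj a1) // farC; apply: rel_pos_far s1 a2.
- by rewrite (content_lt_adj_far a2) // farC; apply: rel_pos_far s2 a1.
Qed.

Lemma content_btw_adj_far h x y z : adj h x -> far x z -> content_btw x z y -> content_btw h z y.
Proof. by case: h x y z => h1 h2 [x1 x2] [y1 y2] [z1 z2] /orP[]/eqP[-> ->]; contents. Qed.

Lemma content_btw_mid_adj h x y z : adj h z -> far h x -> far h y -> content_btw x z y -> content_btw x h y.
Proof. by case: h x y z => h1 h2 [x1 x2] [y1 y2] [z1 z2] /orP[]/eqP[-> ->]; contents. Qed.

Lemma content_btw_adj_mid h x y z : adj h x -> far x y -> far x z -> content_btw y x z -> content_btw y h z.
Proof. by case: h x y z => h1 h2 [x1 x2] [y1 y2] [z1 z2] /orP[]/eqP[-> ->]; contents. Qed.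

Lemma content_btw_adj_end h x y z : adj h y -> far h x -> content_btw y x z -> content_btw h x z.
Proof. by case: h x y z => h1 h2 [x1 x2] [y1 y2] [z1 z2] /orP[]/eqP[-> ->]; contents. Qed.

Lemma content_btw_adj_adj_far h x y z : adj h x -> adj x y -> not_diag h y -> far x z ->
  content_btw y x z -> content_btw x h z.
Proof.
case: h x y z => h1 h2 [x1 x2] [y1 y2] [z1 z2] /orP[]/eqP[-> ->] /orP[]/eqP[-> ->];
  by rewrite /not_diag ?eqxx //= => _; contents.
Qed.

Lemma content_btw_adj_adj h x y z : adj h x -> adj x z -> not_diag h z -> content_btw x z y -> content_btw h x y.
Proof.
case: h x y z => h1 h2 [x1 x2] [y1 y2] [z1 z2] /orP[]/eqP[-> ->] /orP[]/eqP[-> ->];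
  by rewrite /not_diag ?eqxx //= => _; contents.
Qed.

Lemma adj_adj_eq h x y z : adj h x -> adj x y -> not_diag h y -> adj x z -> not_diag h z -> y = z.
Proof.
case: h x y z => h1 h2 [x1 x2] [y1 y2] [z1 z2].
by move=> /orP[]/eqP[-> ->] /orP[]/eqP[-> ->] + /orP[]/eqP[-> ->]; rewrite /not_diag /= ?eqxx.
Qed.

Lemma content_btw_neq x y z : content_btw x y z -> x != z.
Proof. by apply: contraTneq => ->; contents. Qed.

Lemma content_btw_nadj x y z : content_btw x y z -> adj x z = false.
Proof.
by case: x y z => x1 x2 [y1 y2] [z1 z2] b; apply/negP => /orP[]/eqP[ez1 ez2]; move: b; rewrite ez1 ez2; contents.
Qed.

Lemma content_btwC x y z : content_btw x y z = content_btw z y x.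
Proof. by rewrite /content_btw orbC. Qed.

Lemma content_btw_nadjC x y z : content_btw x y z -> adj z x = false.
Proof. by rewrite content_btwC => /content_btw_nadj. Qed.

(* Between the right and lower neighbours of [h] in content there is only the
   diagonal of [h]. *)
Lemma content_btw_adj2 h x y z : adj h x -> adj h y -> content_btw x z y -> far h z = false.
Proof.
case: h x y z => h1 h2 [x1 x2] [y1 y2] [z1 z2] /orP[]/eqP[-> ->] /orP[]/eqP[-> ->]; contents.
Qed.

Lemma content_btw_adj2_diag h x y z : adj h x -> adj h y -> rel_pos x z -> rel_pos y z -> content_btw x z y ->
  [/\ adj x z, adj y z & content_btw x h y].
Proof.
move=> hx hy sx sy b; split.
- case a: (adj x z) => //; have := rel_pos_far sx a; move: hx hy b; clear.
  by case: h x y z => h1 h2 [x1 x2] [y1 y2] [z1 z2] /orP[]/eqP[-> ->] /orP[]/eqP[-> ->]; contents.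
- case a: (adj y z) => //; have := rel_pos_far sy a; move: hx hy b; clear.
  by case: h x y z => h1 h2 [x1 x2] [y1 y2] [z1 z2] /orP[]/eqP[-> ->] /orP[]/eqP[-> ->]; contents.
- move: hx hy b; clear.
  by case: h x y z => h1 h2 [x1 x2] [y1 y2] [z1 z2] /orP[]/eqP[-> ->] /orP[]/eqP[-> ->]; contents.
Qed.

(** * Elementary dual equivalences commute with a slide *)

Definition slide3 h x y z :=
  let h1 := if adj h x then x else h in let o1 := if adj h x then h else x in
  let h2 := if adj h1 y then y else h1 in let o2 := if adj h1 y then h1 else y in
  let h3 := if adj h2 z then z else h2 in let o3 := if adj h2 z then h2 else z in
  (o1, o2, o3, h3).

Lemma chain_swap D x y s : valid D [:: x, y & s] ->
  valid D [:: if adj x y then x else y, if adj x y then y else x & s].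
Proof. by move=> v; case: ifP => // a; apply: valid_swap v _; rewrite a. Qed.

(** The relations between nearby cells that hold at the successive stages of the slide, each
    obtained from the validity of the partly slid list. *)
Definition info3 h x y z :=
  let h1 := if adj h x then x else h in
  let h2 := if adj h1 y then y else h1 in
  [/\ rel_pos h x, rel_pos y z, not_diag h y, not_diag h1 z & rel_pos h1 y /\ rel_pos h2 z].

Lemma valid_info3 D h x y z : ideal D -> valid D [:: h; x; y; z] -> info3 h x y z.
Proof.
move=> iD v; have [s1 s2 d1] := chain3 iD v.
have [iD1 v1] := valid_tail iD v; have [_ s3 _] := chain3 iD1 v1.
have {}v := chain_swap v; have [_ s4 _] := chain3 iD v.
have [iD2 {}v] := valid_tail iD v; have [_ _ d2] := chain3 iD2 v.
have {}v := chain_swap v; have [_ s5 _] := chain3 iD2 v.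
by split.
Qed.

Definition dual_slides (u v : cell * cell * cell * cell) :=
  (u.2 == v.2) && dual_move u.1.1.1 u.1.1.2 u.1.2 v.1.1.1 v.1.1.2 v.1.2.

Lemma dual_slides_sym u v : dual_slides u v = dual_slides v u.
Proof.
rewrite /dual_slides eq_sym; congr andb; move: u v => [[[x y] z] _] [[[x' y'] z'] _] /=.
apply/idP/idP => /orP[]/and4P[/eqP-> /eqP-> /eqP-> b]; rewrite /dual_move !eqxx.
- by rewrite content_btwC b.
- by rewrite (content_btwC z) b orbT.
- by rewrite content_btwC b.
- by rewrite (content_btwC z') b orbT.
Qed.

Lemma dual_slides_l x y z f : content_btw x z y -> dual_slides (x, y, z, f) (y, x, z, f).
Proof. by move=> b; rewrite /dual_slides /dual_move /= !eqxx b. Qed.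

Lemma dual_slides_r x y z f : content_btw y x z -> dual_slides (x, y, z, f) (x, z, y, f).
Proof. by move=> b; rewrite /dual_slides /dual_move /= !eqxx b orbT. Qed.

(** If the hole touches both [x] and [y], then [z] touches both as well, and the slide turns the
    move into one on the last two entries, with [h] as the witness in between. Otherwise the move
    stays on the first two entries. *)
Lemma slide3_dual_l D h x y z : ideal D -> valid D [:: h; x; y; z] ->
  valid D [:: h; y; x; z] -> content_btw x z y -> dual_slides (slide3 h x y z) (slide3 h y x z).
Proof.
move=> iD /(valid_info3 iD) + /(valid_info3 iD) + b.
have nxy := content_btw_nadj b; have nyx := content_btw_nadjC b.
have b' : content_btw y z x by rewrite content_btwC.
rewrite /info3 /slide3 /=.
case e1: (adj h x); case e2: (adj h y); rewrite ?nxy ?nyx ?e1 ?e2.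
- move=> [_ syz _ _ _] [_ sxz _ _ _].
  have [-> -> bh] := content_btw_adj2_diag e1 e2 sxz syz b.
  by apply: dual_slides_r; rewrite content_btwC.
- move=> [_ _ _ _ [_ sxz]] [_ _ _ dhz _].
  case e3: (adj x z); apply: dual_slides_l; first exact: content_btw_adj_adj e1 e3 dhz b.
  exact: content_btw_adj_far e1 (rel_pos_far sxz e3) b.
- move=> [_ _ _ dhz _] [_ _ _ _ [_ syz]]; rewrite dual_slides_sym.
  case e3: (adj y z); apply: dual_slides_l; first exact: content_btw_adj_adj e2 e3 dhz b'.
  exact: content_btw_adj_far e2 (rel_pos_far syz e3) b'.
- move=> [shx _ _ _ _] [shy _ _ _ _].
  case e3: (adj h z); apply: dual_slides_l => //.
  exact: content_btw_mid_adj e3 (rel_pos_far shx e1) (rel_pos_far shy e2) b.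
Qed.

(** Here the move always stays on the last two entries: the hole cannot choose between [y] and [z],
    because either they would coincide or [x] would have the content of [h] without being near
    it. *)
Lemma slide3_dual_r D h x y z : ideal D -> valid D [:: h; x; y; z] ->
  valid D [:: h; x; z; y] -> content_btw y x z -> dual_slides (slide3 h x y z) (slide3 h x z y).
Proof.
move=> iD /(valid_info3 iD) + /(valid_info3 iD) + b.
have nyz := content_btw_nadj b; have nzy := content_btw_nadjC b.
have b' : content_btw z x y by rewrite content_btwC.
rewrite /info3 /slide3 /=.
case e1: (adj h x).
- case e3: (adj x y); case e4: (adj x z); rewrite ?nyz ?nzy ?e3 ?e4.
  + move=> [_ _ dy _ _] [_ _ dz _ _].
    by have := content_btw_neq b; rewrite (adj_adj_eq e1 e3 dy e4 dz) eqxx.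
  + move=> [_ _ dy _ _] [_ _ _ _ [sxz _]]; apply: dual_slides_r.
    exact: content_btw_adj_adj_far e1 e3 dy (rel_pos_far sxz e4) b.
  + move=> [_ _ _ _ [sxy _]] [_ _ dz _ _]; rewrite dual_slides_sym; apply: dual_slides_r.
    exact: content_btw_adj_adj_far e1 e4 dz (rel_pos_far sxy e3) b'.
  + move=> [_ _ _ _ [sxy _]] [_ _ _ _ [sxz _]]; apply: dual_slides_r.
    exact: content_btw_adj_mid e1 (rel_pos_far sxy e3) (rel_pos_far sxz e4) b.
- case e3: (adj h y); case e4: (adj h z); rewrite ?nyz ?nzy ?e3 ?e4.
  + move=> [shx _ _ _ _] _.
    by have := rel_pos_far shx e1; rewrite (content_btw_adj2 e3 e4 b).
  + move=> [shx _ _ _ _] _; apply: dual_slides_r.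
    exact: content_btw_adj_end e3 (rel_pos_far shx e1) b.
  + move=> [shx _ _ _ _] _; rewrite dual_slides_sym; apply: dual_slides_r.
    exact: content_btw_adj_end e4 (rel_pos_far shx e1) b'.
  + by move=> _ _; apply: dual_slides_r.
Qed.

(** * Dual equivalence *)

(** The operator behind evacuation: the smallest entry is deleted and the hole slides out, vacating
    [corner s]. *)
Definition Delta (s : seq cell) := if s is a :: s' then outs a s' else [::].
Definition corner (s : seq cell) := if s is a :: s' then hole a s' else (0, 0).

Lemma Delta_cons a s : Delta (a :: s) = outs a s. Proof. by []. Qed.

Lemma valid_catl D s1 s2 : valid D (s1 ++ s2) -> valid D s1.
Proof. by rewrite valid_cat => /andP[]. Qed.

Lemma slide_valid_cat D h s u :
  valid D (h :: s ++ u) -> valid D (outs h s ++ hole h s :: u).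
Proof.
rewrite -cat_cons valid_cat => /andP[/slide_valid vs vu].
rewrite -cat_rcons valid_cat vs /=; rewrite -(eq_valid _ (D := (h :: s) ++ D)) // => x.
by rewrite [LHS]mem_cat [RHS]mem_cat (perm_mem (slide_perm h s)).
Qed.

Lemma Delta_valid s : valid [::] s -> valid [::] (rcons (Delta s) (corner s)).
Proof. by case: s => [|a s] // /slide_valid. Qed.

Lemma Delta_valid1 s : valid [::] s -> valid [::] (Delta s).
Proof. by move/Delta_valid; rewrite -cats1; apply: valid_catl. Qed.

Lemma iter_Delta_valid j s : valid [::] s -> valid [::] (iter j Delta s).
Proof. by move=> v; elim: j => //= j; apply: Delta_valid1. Qed.

Lemma size_Delta s : size (Delta s) = (size s).-1.
Proof. by case: s => //= a s; rewrite size_outs. Qed.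

Lemma size_iter_Delta j s : size (iter j Delta s) = size s - j.
Proof. by elim: j => [|j IH] /=; rewrite ?subn0 // size_Delta IH; lia. Qed.

Lemma Delta_perm s : s != [::] -> perm_eq (rcons (Delta s) (corner s)) s.
Proof. by case: s => //= a s _; apply: slide_perm. Qed.

Lemma outs3 h x y z B o1 o2 o3 f : slide3 h x y z = (o1, o2, o3, f) ->
  outs h [:: x, y, z & B] = [:: o1, o2, o3 & outs f B].
Proof.
by rewrite /slide3 /=; case: (adj h x) => /=; case: (adj _ y) => /=; case: (adj _ z) => -[<- <- <- <-].
Qed.

(* An elementary move that leaves the first [p] entries untouched. *)
Definition dual_step p s s' := exists A x y z x' y' z' B,
  [/\ s = A ++ [:: x, y, z & B], s' = A ++ [:: x', y', z' & B],
      dual_move x y z x' y' z', p <= size A & valid [::] s /\ valid [::] s'].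

(** The common prefix [A] brings the same hole [f] to the three cells, and the local lemmas return
    the same hole behind them, so [B] slides identically. The index drops because the first entry
    disappears. *)
Lemma dual_step_Delta p s s' : dual_step p.+1 s s' -> dual_step p (Delta s) (Delta s').
Proof.
move=> [A [x [y [z [x' [y' [z' [B [es es' dk sA [v v']]]]]]]]]].
have := Delta_valid1 v; have := Delta_valid1 v'.
case: A sA es es' => //= a A sA es es'; rewrite es es' in v v' *.
rewrite !Delta_cons !outs_cat; set f := hole a A.
have {v} v := slide_valid_cat v; have {v'} v' := slide_valid_cat v'.
have iD : ideal (outs a A ++ [::]) by rewrite cats0; apply/valid0_ideal/valid_catl/v.
rewrite !valid_cat -/f in v v'.
have {}v : valid (outs a A ++ [::]) [:: f; x; y; z].
  by case/andP: v => _; rewrite -[_ :: _]/([:: f; x; y; z] ++ B); apply: valid_catl.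
have {}v' : valid (outs a A ++ [::]) [:: f; x'; y'; z'].
  by case/andP: v' => _; rewrite -[_ :: _]/([:: f; x'; y'; z'] ++ B); apply: valid_catl.
have {dk} dk : dual_slides (slide3 f x y z) (slide3 f x' y' z').
  case/orP: dk v v' => /and4P[/eqP-> /eqP-> /eqP-> b] v v'.
    exact: slide3_dual_l iD v v' b.
  exact: slide3_dual_r iD v v' b.
case E: (slide3 f x y z) dk => [[[o1 o2] o3] g].
case E': (slide3 f x' y' z') => [[[o1' o2'] o3'] g'] /andP[/eqP gg dk]; rewrite /= in gg dk; rewrite -gg in E'.
rewrite (outs3 B E) (outs3 B E') => w w'.
exists (outs a A), o1, o2, o3, o1', o2', o3', (outs g B).
by split => //; rewrite size_outs.
Qed.

Inductive dual_equiv p : seq cell -> seq cell -> Prop :=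
  | dual_refl s : dual_equiv p s s
  | dual_cons s s' s'' : dual_step p s s' -> dual_equiv p s' s'' -> dual_equiv p s s''.

Lemma dual_equiv_trans p s s' s'' : dual_equiv p s s' -> dual_equiv p s' s'' -> dual_equiv p s s''.
Proof. by move=> d; elim: d s'' => // {s s'} s s' t st _ IH s'' /IH; apply: dual_cons. Qed.

Lemma dual_equiv1 p s s' : dual_step p s s' -> dual_equiv p s s'.
Proof. by move=> st; apply: dual_cons st (dual_refl _ _). Qed.

Lemma dual_equiv_weak p q s s' : q <= p -> dual_equiv p s s' -> dual_equiv q s s'.
Proof.
move=> qp; elim=> {s s'} [s|s s' t st _ IH]; first exact: dual_refl.
apply: dual_cons IH; case: st => [A [x [y [z [x' [y' [z' [B [? ? ? ? ?]]]]]]]]].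
by exists A, x, y, z, x', y', z', B; split => //; lia.
Qed.

Lemma dual_equiv_Delta p s s' : dual_equiv p.+1 s s' -> dual_equiv p (Delta s) (Delta s').
Proof.
elim=> {s s'} [s|s s' t st _ IH]; first exact: dual_refl.
exact: dual_cons (dual_step_Delta st) IH.
Qed.

Lemma dual_equiv_iter_Delta j p s s' : dual_equiv (j + p) s s' ->
  dual_equiv p (iter j Delta s) (iter j Delta s').
Proof.
elim: j p => // j IH p; rewrite addSnnS => /IH /=; exact: dual_equiv_Delta.
Qed.

Lemma dual_equiv_perm p s s' : dual_equiv p s s' -> perm_eq s s'.
Proof.
elim=> {s s'} [s|s s' t [A [x [y [z [x' [y' [z' [B [-> -> dk _ _]]]]]]]]] _]; first exact: perm_refl.
apply: perm_trans; rewrite perm_cat2l.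
case/orP: dk => /and4P[/eqP-> /eqP-> /eqP-> _].
  by rewrite -[X in perm_eq X _]/([:: x] ++ [:: y] ++ z :: B) perm_catCA.
by rewrite perm_cons -[X in perm_eq X _]/([:: y] ++ [:: z] ++ B) perm_catCA.
Qed.

(** * Completions of partial fillings and their dual equivalence *)

Lemma exists_addable D (v : cell) : v \notin D ->
  exists y, [/\ addable D y, y.1 <= v.1 & y.2 <= v.2].
Proof.
move: {2}(v.1 + v.2) (erefl (v.1 + v.2)) => m.
elim: m v => [|m IH] v em nv.
  exists v; split => //; rewrite /addable nv; apply/and3P; split => //; lia.
have [e1|e1] := boolP ((v.1 == 0) || ((v.1.-1, v.2) \in D)); last first.
  move: e1; rewrite negb_or => /andP[v1 nv1].
  case: (IH _ _ nv1) => [/=|y [ay y1 y2]]; first lia.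
  by exists y; split => //; move: y1 => /=; lia.
have [e2|e2] := boolP ((v.2 == 0) || ((v.1, v.2.-1) \in D)); last first.
  move: e2; rewrite negb_or => /andP[v1 nv1].
  case: (IH _ _ nv1) => [/=|y [ay y1 y2]]; first lia.
  by exists y; split => //; move: y2 => /=; lia.
by exists v; split => //; rewrite /addable nv e1.
Qed.

Definition in_rect r c (x : cell) := (x.1 < r) && (x.2 < c).
Definition rect_cells r c : seq cell := [seq (i, k) | i <- iota 0 r, k <- iota 0 c].

Lemma mem_rect_cells r c x : (x \in rect_cells r c) = in_rect r c x.
Proof.
case: x => i k; apply/allpairsP/idP => [[[i' k'] /= [+ + [-> ->]]]|/andP[/= ir kc]].
  by rewrite !mem_iota /in_rect /=; lia.
by exists (i, k); rewrite !mem_iota /=; split => //; lia.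
Qed.

Lemma rect_cells_uniq r c : uniq (rect_cells r c).
Proof. by apply: allpairs_uniq => [||[a b] [a' b']] //=; apply: iota_uniq. Qed.

Lemma size_rect_cells r c : size (rect_cells r c) = r * c.
Proof. by rewrite size_allpairs !size_iota. Qed.

(* The cell lists of standard fillings of the [r] by [c] rectangle. *)
Definition full r c s := valid [::] s && perm_eq s (rect_cells r c).

Lemma full_mem r c s x : full r c s -> (x \in s) = in_rect r c x.
Proof. by case/andP => _ /perm_mem ->; rewrite mem_rect_cells. Qed.

Lemma fullP r c s : valid [::] s -> (forall x, (x \in s) = in_rect r c x) -> full r c s.
Proof.
move=> v e; rewrite /full v; apply: uniq_perm; rewrite ?rect_cells_uniq ?(valid0_uniq v) //.
by move=> x; rewrite e mem_rect_cells.
Qed.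

Lemma valid_rcons D s x : valid D (rcons s x) = valid D s && addable (s ++ D) x.
Proof. by rewrite -cats1 valid_cat /= andbT. Qed.

(** Greedy filling: as long as a cell of the rectangle is missing, some cell weakly north-west of it
    can be added. *)
Lemma full_extend r c U : valid [::] U -> {in U, forall x, in_rect r c x} ->
  exists W, full r c (U ++ W).
Proof.
move: {2}(r * c - size U) (leqnn (r * c - size U)) => m.
elim: m U => [|m IH] U sz v inU.
  exists [::]; rewrite cats0; apply: fullP => // x; rewrite -mem_rect_cells.
  have sub : {subset U <= rect_cells r c} by move=> y /inU; rewrite mem_rect_cells.
  have le : size (rect_cells r c) <= size U by rewrite size_rect_cells; lia.
  by have [_ ->] := uniq_min_size (valid0_uniq v) sub le.
have [al|/allPn [y yR yU]] := boolP (all (fun x => x \in U) (rect_cells r c)).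
  exists [::]; rewrite cats0; apply: fullP => // x; apply/idP/idP => [/inU//|].
  by rewrite -mem_rect_cells => /(allP al).
have [z [az z1 z2]] := exists_addable yU.
rewrite mem_rect_cells in yR; have zR : in_rect r c z by move: yR; rewrite /in_rect; lia.
have /= [|||W] := IH (rcons U z).
- rewrite size_rcons; suff : size U < r * c by lia.
  rewrite -size_rect_cells; rewrite ltnNge; apply/negP => le.
  have sub : {subset U <= rect_cells r c} by move=> x /inU; rewrite mem_rect_cells.
  have [_ /(_ y)] := uniq_min_size (valid0_uniq v) sub le.
  by rewrite (negPf yU) mem_rect_cells yR.
- by rewrite valid_rcons v cats0.
- by move=> x; rewrite mem_rcons inE => /orP[/eqP->|/inU].
by rewrite cat_rcons => f; exists (z :: W).
Qed.

Lemma addable_cons D x y : addable D y -> y != x -> addable (x :: D) y.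
Proof.
rewrite /addable !inE negb_or => /and3P[-> u l] -> /=.
by case/orP: u => ->; case/orP: l => ->; rewrite ?orbT.
Qed.

Lemma exists_content_btw D x y : ideal D -> addable D x -> addable D y -> x != y ->
  exists z, [/\ addable [:: y, x & D] z, content_btw x z y &
    forall r c, in_rect r c x -> in_rect r c y -> in_rect r c z].
Proof.
move=> iD ax ay nxy.
have ayx : addable (x :: D) y by apply: addable_cons; rewrite // eq_sym.
have iD1 := addable_ideal iD ax; have iD2 := addable_ideal iD1 ayx.
have nx : x \notin D by case/and3P: ax.
have ny : y \notin D by case/and3P: ay.
have H u v : addable D u -> addable D v -> u != v -> ~ (v.1 <= u.1 /\ v.2 <= u.2).
  move=> au av nuv [l1 l2]; have := addable_ideal iD au (mem_head _ _) l1 l2.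
  by rewrite inE eq_sym (negPf nuv); case/and3P: av => /negPf ->.
have nH1 := H _ _ ax ay nxy; have nH2 := H _ _ ay ax; rewrite eq_sym in nH2; move/(_ nxy): nH2 => nH2.
(* An addable cell weakly north-west of the join of [x] and [y], but not weakly north-west of
   either, has content strictly between theirs. *)
pose v : cell := (maxn x.1 y.1, maxn x.2 y.2).
have vD : v \notin [:: y, x & D].
  rewrite !inE !negb_or; apply/and3P; split.
  - by apply/eqP => e; apply: nH1; split; rewrite -?e /=; move/(congr1 fst): (e); move/(congr1 snd): (e) => /=; lia.
  - by apply/eqP => e; apply: nH1; split; rewrite -?e /=; move/(congr1 fst): (e); move/(congr1 snd): (e) => /=; lia.
  - by apply/negP => /iD /(_ x); rewrite (negPf nx) /= !leq_max !leqnn => /(_ isT isT).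
have [z [az z1 z2]] := exists_addable vD.
exists z; rewrite /= in z1 z2; split => //; last first.
  move=> r c /andP[x1 x2] /andP[y1 y2]; rewrite /in_rect.
  by rewrite (leq_ltn_trans z1) ?(leq_ltn_trans z2) // gtn_max ?x1 ?x2.
have nz : z \notin [:: y, x & D] by case/and3P: az.
have zx : ~ (z.1 <= x.1 /\ z.2 <= x.2).
  by case=> l1 l2; move: nz; rewrite (iD2 x) // !inE eqxx orbT.
have zy : ~ (z.1 <= y.1 /\ z.2 <= y.2).
  by case=> l1 l2; move: nz; rewrite (iD2 y) // !inE eqxx.
move: z1 z2 zx zy nH1 nH2; clear; case: x y z => [a b] [a' b'] [a'' b''].
by rewrite /content_btw /content_lt /=; lia.
Qed.

Lemma full_size r c U V V' : full r c (U ++ V) -> full r c (U ++ V') -> size V = size V'.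
Proof.
case/andP=> _ p /andP[_ p']; rewrite perm_sym in p'.
by have := perm_trans p p'; rewrite perm_cat2l => /perm_size.
Qed.

(** Induction on the number of remaining entries. If the first cells [x] and [y] differ, both
    fillings are connected to ones continuing with [x, y, z] and [y, x, z], which differ by an
    elementary move witnessed by [z]. *)
Lemma dual_equiv_connect r c U V V' : full r c (U ++ V) -> full r c (U ++ V') ->
  dual_equiv (size U) (U ++ V) (U ++ V').
Proof.
move: {2}(size V) (erefl (size V)) => m.
elim: m U V V' => [|m IH] U V V' sV f f'.
  have := full_size f f'; rewrite sV; case: V f sV => //; case: V' f' => // *; exact: dual_refl.
have sV' : size V' = m.+1 by rewrite -(full_size f f').
case: V V' sV sV' f f' => [|x V] [|y V'] // [sV] [sV'] f f'.
have R t W W' : full r c (U ++ t :: W) -> full r c (U ++ t :: W') -> size W = m ->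
    dual_equiv (size U) (U ++ t :: W) (U ++ t :: W').
  by rewrite -!cat_rcons => g g' sW; apply: dual_equiv_weak (IH _ _ _ sW g g'); rewrite size_rcons.
have [exy|nxy] := eqVneq x y; first by rewrite -exy in f' *; apply: R.
have [vU ax] : valid [::] U /\ addable U x.
  by case/andP: f; rewrite valid_cat cats0 /= => /and3P[].
have ay : addable U y by case/andP: f'; rewrite valid_cat cats0 /= => /and3P[].
have [z [az bz inz]] := exists_content_btw (valid0_ideal vU) ax ay nxy.
have xR : in_rect r c x by rewrite -(full_mem _ f) mem_cat mem_head orbT.
have yR : in_rect r c y by rewrite -(full_mem _ f') mem_cat mem_head orbT.
have vz : valid [::] (U ++ [:: x; y; z]).
  by rewrite valid_cat vU cats0 /= ax az addable_cons // eq_sym.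
have [|W fW] := @full_extend r c _ vz.
  move=> u; rewrite mem_cat !inE => /or4P[uU|/eqP->|/eqP->|/eqP->] //; last exact: inz.
  by rewrite -(full_mem _ f) mem_cat uU.
rewrite -catA /= in fW.
have fW' : full r c (U ++ [:: y, x, z & W]).
  case/andP: fW => v p; apply/andP; split.
    rewrite !valid_cat in v *; case/andP: v => -> v; apply: valid_swap v _.
    by rewrite (content_btw_nadj bz).
  apply: perm_trans p; rewrite perm_cat2l.
  by rewrite -[X in perm_eq X _]/([:: y] ++ [:: x] ++ z :: W) perm_catCA.
have sW : size [:: y, z & W] = m by have := full_size f fW => /= -[<-].
have sW' : size [:: x, z & W] = m by have := full_size f' fW' => /= -[<-].
apply: (dual_equiv_trans (R _ _ _ f fW sV)).
apply: (dual_equiv_trans _ (R _ _ _ fW' f' sW')).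
apply: dual_equiv1; exists U, x, y, z, y, x, z, W; split => //.
  by rewrite /dual_move !eqxx bz.
by case/andP: fW; case/andP: fW'.
Qed.

(** * Evacuation of rectangles *)

Lemma content_lt_Delta A x y B : valid [::] (A ++ [:: x, y & B]) -> 0 < size A ->
  exists A' x' y' B', [/\ Delta (A ++ [:: x, y & B]) = A' ++ [:: x', y' & B'],
    size A' = (size A).-1 & content_lt x' y' = content_lt x y].
Proof.
case: A => // a A v _; rewrite cat_cons Delta_cons outs_cat.
have {v} v := slide_valid_cat v; set f := hole a A in v *.
have iD : ideal (outs a A ++ [::]) by rewrite cats0; apply/valid0_ideal/valid_catl/v.
rewrite valid_cat in v.
have {}v : valid (outs a A ++ [::]) [:: f; x; y].
  by case/andP: v => _; rewrite -[_ :: _]/([:: f; x; y] ++ B); apply: valid_catl.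
have := slide2_content_lt iD v; rewrite -[[:: x, y & B]]/([:: x; y] ++ B) outs_cat.
have := size_outs f [:: x; y]; case: (outs f [:: x; y]) => [|o1 [|o2 []]] // _ /(_ _ _ erefl) e.
by exists (outs a A), o1, o2, (outs (hole f [:: x; y]) B); rewrite size_outs.
Qed.

Lemma content_lt_iter_Delta A x y B : valid [::] (A ++ [:: x, y & B]) ->
  exists x' y' B', iter (size A) Delta (A ++ [:: x, y & B]) = [:: x', y' & B'] /\
    content_lt x' y' = content_lt x y.
Proof.
move: {2}(size A) (erefl (size A)) => m; elim: m A x y B => [|m IH] A x y B sA v.
  by rewrite sA /=; case: A sA {v} => // _; exists x, y, B.
have := Delta_valid1 v.
have [|A' [x' [y' [B' [eD sA' e]]]]] := content_lt_Delta v; first lia.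
rewrite eD; case/IH => [|x2 [y2 [B2 [e1 e2]]]]; first lia.
exists x2, y2, B2; rewrite e2 e sA iterSr eD -e1; split => //; congr iter; lia.
Qed.

(** The two holes pass each cell of [B] one after the other, and [slide2_hole] keeps their order at
    each passage. *)
Lemma content_lt_holes D h2 h1 B : ideal D -> valid D [:: h2, h1 & B] ->
  content_lt (hole h2 (outs h1 B)) (hole h1 B) = content_lt h2 h1.
Proof.
elim: B D h2 h1 => // a B IH D h2 h1 iD v.
have v3 : valid D [:: h2; h1; a].
  by move: v; rewrite -[[:: h2, h1, a & B]]/([:: h2; h1; a] ++ B); apply: valid_catl.
have E := slide2_hole iD v3.
have {}v : valid D [:: h2, (if adj h1 a then h1 else a), (if adj h1 a then a else h1) & B].
  by case: ifP => na //; apply: valid_swap2 v _; rewrite na.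
move: E; rewrite /=; case: (adj h1 a) v => v /(_ _ _ erefl) /= E; rewrite -E.
  case: ifP E v => na E v; last first.
    have {}v : valid D [:: h1, h2, a & B] by apply: valid_swap v _; rewrite na.
    by have [iD' v'] := valid_tail iD v; apply: IH v'.
  by have [iD' v'] := valid_tail iD v; apply: IH v'.
case: ifP E v => na E v; last first.
  have {}v : valid D [:: a, h2, h1 & B] by apply: valid_swap v _; rewrite na.
  by have [iD' v'] := valid_tail iD v; apply: IH v'.
by have [iD' v'] := valid_tail iD v; apply: IH v'.
Qed.

Lemma addable_nil x : addable [::] x -> x = (0, 0).
Proof. by case: x => a b; rewrite /addable /= !in_nil !orbF => /andP[/eqP-> /eqP->]. Qed.

(** As [x] is the origin, the first hole moves to [y] at once, while the second slide starts again
    at [x]; so the holes start from [y] and [x]. *)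
Lemma content_lt_corner x y B : valid [::] [:: x, y & B] ->
  content_lt (corner (Delta [:: x, y & B])) (corner [:: x, y & B]) = content_lt x y.
Proof.
move=> v; have a : adj x y.
  have := valid_rel_pos ideal0 v; have /= /andP[/addable_nil -> _] := v.
  by rewrite /rel_pos !ltn0 andbF /= !orbF.
by rewrite /= a; apply: content_lt_holes v.
Qed.

Definition rotate r c (x : cell) : cell := (r.-1 - x.1, c.-1 - x.2).

Lemma rotateK r c x : in_rect r c x -> rotate r c (rotate r c x) = x.
Proof. by case: x => a b; rewrite /rotate /in_rect /= => ?; congr pair; lia. Qed.

Lemma rotate_in_rect r c x : in_rect r c x -> in_rect r c (rotate r c x).
Proof. by case: x => a b; rewrite /rotate /in_rect /=; lia. Qed.

Lemma corner_eq L (x : cell) V : L != [::] -> perm_eq L (x :: V) ->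
  perm_eq (Delta L) V -> corner L = x.
Proof.
move=> n p pD; have p1 := Delta_perm n.
have : perm_eq (rcons (Delta L) (corner L)) (rcons (Delta L) x).
  apply: (perm_trans p1); apply: (perm_trans p).
  by rewrite perm_sym perm_rcons perm_cons.
by rewrite -!cats1 perm_cat2l => /perm_mem/(_ x); rewrite !inE eqxx => /eqP.
Qed.

Lemma mem_drop_full r c s j v : full r c s ->
  (v \in drop j s) = in_rect r c v && (v \notin take j s).
Proof.
move=> f; rewrite -(full_mem _ f) -{2}(cat_take_drop j s) mem_cat.
have : uniq s by case/andP: f => /valid0_uniq.
rewrite -{1}(cat_take_drop j s) cat_uniq => /and3P[_ /hasPn h _].
by case: (boolP (v \in drop j s)) => [/h/=|_]; rewrite ?orbF; case: (v \in take j s).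
Qed.

Lemma rotate_inj_in r c : {in in_rect r c &, injective (rotate r c)}.
Proof. by move=> x y xR yR e; rewrite -(rotateK xR) e rotateK. Qed.

Lemma ltn_sub_rev m i k : i <= k -> k < m -> m.-1 - k < m - i.
Proof. by lia. Qed.

Lemma leq_sub_rev m i k : k < m - i -> i <= m.-1 - k.
Proof. by lia. Qed.

(* [(f1, f2)] is addable to an [a] by [b] rectangle without its corner; the last two
   hypotheses exclude the ends of its first row and first column. *)
Lemma rect_corner a b f1 f2 : 0 < a -> 0 < b ->
  ~~ [&& f1 < a, f2 < b & (f1, f2) != (a.-1, b.-1)] ->
  (f1 == 0) || [&& f1.-1 < a, f2 < b & (f1.-1, f2) != (a.-1, b.-1)] ->
  (f2 == 0) || [&& f1 < a, f2.-1 < b & (f1, f2.-1) != (a.-1, b.-1)] ->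
  (1 < b -> b.-2 + f1 < f2 + a.-1) -> (1 < a -> ~~ (b.-1 + f1 < f2 + a.-2)) ->
  f1 = a.-1 /\ f2 = b.-1.
Proof.
move=> a0 b0 nf uf lf Hr Hd; have [l1|l1] := ltnP f1 a; last first.
  case/orP: uf => [/eqP e|/and3P[p1 p2 ne]]; first by move: l1; rewrite e; lia.
  have e1 : f1 = a by lia.
  case/orP: lf => [/eqP e2|/and3P[]]; last by rewrite e1 ltnn.
  have b1 : 1 < b by move: ne; rewrite e1 e2 xpair_eqE eqxx /=; lia.
  by have := Hr b1; rewrite e1 e2; lia.
have [l2|l2] := ltnP f2 b; last first.
  case/orP: lf => [/eqP e|/and3P[p1 p2 ne]]; first by move: l2; rewrite e; lia.
  have e2 : f2 = b by lia.
  case/orP: uf => [/eqP e1|/and3P[_]]; last by rewrite e2 ltnn.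
  have a1 : 1 < a by move: ne; rewrite e1 e2 xpair_eqE eqxx andbT /=; lia.
  by have := Hd a1; rewrite e1 e2; lia.
by move: nf; rewrite l1 l2 /= negbK => /eqP[-> ->].
Qed.

Section EvacStep.

(* Step of a downward induction on [j]: [V] holds the cells of the entries after [x],
   and [L] the filling left by [s] after [j] slides. *)

Variables (r c j : nat) (s U V L : seq cell) (x : cell).
Hypothesis fs : full r c s.
Hypothesis IH : forall t i, full r c t -> j < i -> i <= size t ->
  perm_eq (iter i Delta t) (map (rotate r c) (drop i t)).
Hypothesis es : s = U ++ x :: V.
Hypothesis sU : size U = j.
Hypothesis eL : L = iter j Delta s.

Let vU : valid [::] U /\ addable U x.
Proof. by case/andP: fs; rewrite es valid_cat cats0 /= => /and3P[]. Qed.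

Let vL : valid [::] L.
Proof. by rewrite eL; apply: iter_Delta_valid; case/andP: fs. Qed.

Let drop1 a W : drop j.+1 (U ++ a :: W) = W.
Proof. by rewrite -cat_rcons drop_size_cat // size_rcons sU. Qed.

Let drop2 a b W : drop j.+2 (U ++ [:: a, b & W]) = W.
Proof. by rewrite -!cat_rcons drop_size_cat // !size_rcons sU. Qed.

Let js : j < size s.
Proof. by rewrite es size_cat sU /= addnS ltnS leq_addr. Qed.

Let pDL : perm_eq (Delta L) (map (rotate r c) V).
Proof. by rewrite eL -iterS -(drop1 x V) -es; apply: IH. Qed.

Let nL : L != [::].
Proof. by rewrite -size_eq0 eL size_iter_Delta subn_eq0 -ltnNge. Qed.

Lemma evac_perm_suffix W : full r c (U ++ W) -> perm_eq L (iter j Delta (U ++ W)).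
Proof.
move=> fW; have := fs; rewrite es => fs'; rewrite eL es.
have := dual_equiv_connect fs' fW; rewrite sU -{1}[j]addn0 => /dual_equiv_iter_Delta.
exact: dual_equiv_perm.
Qed.

(* Two possible next cells [x] and [y] yield two subsets of the shape of [L]. *)
Lemma evac_corner_two y : addable U y -> in_rect r c y -> y != x -> corner L = rotate r c x.
Proof.
move=> ay yR nyx.
have [vU' ax] := vU.
have [W fW] : exists W, full r c (rcons U y ++ W).
  apply: full_extend; first by rewrite valid_rcons cats0 vU'.
  move=> u; rewrite mem_rcons inE => /orP[/eqP->//|uU].
  by rewrite -(full_mem _ fs) es mem_cat uU.
have fW' := fW; rewrite cat_rcons in fW'.
have pL := evac_perm_suffix fW'.
have xW : x \in W.
  have : x \in rcons U y ++ W by rewrite (full_mem _ fW) -(full_mem _ fs) es mem_cat mem_head orbT.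
  rewrite mem_cat mem_rcons inE eq_sym (negPf nyx) /=.
  by case/orP => //; case/and3P: ax => /negPf ->.
(* In a completion taking [y] next, [x] is still to come, so by induction its rotation survives one
   more slide; in the original filling it does not. *)
have rL : rotate r c x \in L.
  rewrite (perm_mem pL).
  have n' : iter j Delta (U ++ y :: W) != [::].
    by rewrite -size_eq0 size_iter_Delta size_cat sU addKn.
  rewrite -(perm_mem (Delta_perm n')) mem_rcons inE -iterS.
  rewrite (perm_mem (IH _ _ _)) //; last by rewrite size_cat sU addnS ltnS leq_addr.
  by rewrite drop1 map_f ?orbT.
rewrite -(perm_mem (Delta_perm nL)) mem_rcons inE (perm_mem pDL) in rL.
case/orP: rL => [/eqP//|/mapP[v vV e]].
have xv : x = v.
  apply: rotate_inj_in e; rewrite -topredE /= -(full_mem _ fs) es mem_cat inE ?eqxx ?orbT //.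
  by rewrite vV !orbT.
have := fs; rewrite es => /andP[/valid0_uniq]; rewrite cat_uniq /= xv vV /=.
by rewrite !andbF.
Qed.

(** The entries after time [j] are rearranged so that [t] follows [x]. This changes neither the
    cells of [L] nor those of [Delta L], hence not the corner, and the next corner is known by
    induction; the descent at [x, t] then compares the two corners. *)
Lemma evac_corner_adj t : adj x t -> in_rect r c t -> addable (x :: U) t ->
  content_lt (rotate r c t) (corner L) = content_lt x t.
Proof.
move=> axt tR at_.
have [vU' ax] := vU.
have [W fW] : exists W, full r c (rcons (rcons U x) t ++ W).
  apply: full_extend.
    rewrite !valid_rcons !cats0 vU' ax /= -(eq_addable (D := x :: U)) // => z.
    by rewrite mem_rcons.
  move=> u; rewrite !(mem_rcons, inE) => /or3P[/eqP->//|/eqP->|uU].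
    by rewrite -(full_mem _ fs) es mem_cat mem_head orbT.
  by rewrite -(full_mem _ fs) es mem_cat uU.
rewrite !cat_rcons in fW.
have pL := evac_perm_suffix fW.
have vW : valid [::] (U ++ [:: x, t & W]) by case/andP: fW.
have [x' [y' [B' [eL' a']]]] := content_lt_iter_Delta vW; rewrite sU in eL'.
have p1 : perm_eq (Delta (iter j Delta (U ++ [:: x, t & W]))) (map (rotate r c) (t :: W)).
  have := IH fW (leqnn _); by rewrite drop1; apply; rewrite size_cat sU addnS ltnS leq_addr.
have p2 : perm_eq (Delta (Delta (iter j Delta (U ++ [:: x, t & W])))) (map (rotate r c) W).
  have := IH fW (leqnSn _); by rewrite drop2; apply; rewrite size_cat sU !addnS !ltnS leq_addr.
have c2 : corner (Delta (iter j Delta (U ++ [:: x, t & W]))) = rotate r c t.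
  by apply: (corner_eq _ p1 p2); rewrite -size_eq0 (perm_size p1).
have c1 : corner (iter j Delta (U ++ [:: x, t & W])) = corner L.
  have pV : perm_eq (Delta L) (map (rotate r c) (t :: W)).
    apply: perm_trans pDL _; apply: perm_map.
    have := fW; have := fs; rewrite es => /andP[_ q1] /andP[_]; rewrite perm_sym => q2.
    by have := perm_trans q1 q2; rewrite perm_cat2l perm_cons.
  apply: (@corner_eq _ _ (map (rotate r c) (t :: W))) p1.
    by rewrite -size_eq0 eL'.
  rewrite perm_sym in pL; apply: (perm_trans pL).
  rewrite perm_sym; apply: (perm_trans _ (Delta_perm nL)).
  by rewrite perm_sym perm_rcons perm_cons.
by rewrite -c1 -c2 eL' content_lt_corner // -eL' iter_Delta_valid.
Qed.

Lemma evac_corner : corner L = rotate r c x.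
Proof.
have [vU' ax] := vU.
have xR : in_rect r c x by rewrite -(full_mem _ fs) es mem_cat mem_head orbT.
have [/hasP[y yR /andP[nyx ay]]|/hasPn nh] := boolP (has (fun y => (y != x) && addable U y) (rect_cells r c)).
  by rewrite mem_rect_cells in yR; apply: evac_corner_two ay yR nyx.
(* [x] is now the only addable cell in the rectangle, so the cells outside [U] form the rectangle
   with top-left corner [x]. *)
have nU : forall v, in_rect r c v -> (v \notin U) = (x.1 <= v.1) && (x.2 <= v.2).
  move=> v vR; apply/idP/idP => [/exists_addable [y [ay y1 y2]]|/andP[l1 l2]].
    have yR : in_rect r c y by move: vR; rewrite /in_rect; lia.
    have := nh y; rewrite mem_rect_cells yR ay andbT negbK => /(_ isT) /eqP <-.
    by rewrite y1.
  apply/negP => vU''; case/and3P: ax => /negP nx _ _; apply: nx.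
  exact: (valid0_ideal vU') vU'' _ l1 l2.
have mD (p : cell) : (p \in Delta L) = [&& p.1 < r - x.1, p.2 < c - x.2 & p != rotate r c x].
  rewrite (perm_mem pDL).
  have mV (v : cell) : (v \in V) = [&& in_rect r c v, v \notin U & v != x].
    rewrite -(drop1 x V) -es (mem_drop_full _ _ fs) es -cat_rcons take_size_cat ?size_rcons ?sU //.
    by rewrite mem_rcons inE negb_or (andbC (v != x)).
  apply/mapP/and3P => [[v + ->]|[p1 p2 np]].
    rewrite mV => /and3P[vR]; rewrite (nU _ vR) => /andP[l1 l2] nv.
    have [v1 v2] := andP vR; split; rewrite ?ltn_sub_rev //.
    by apply: contra nv => /eqP /(rotate_inj_in vR xR) ->.
  have pR : in_rect r c p by rewrite /in_rect (leq_trans p1 (leq_subr _ _)) (leq_trans p2 (leq_subr _ _)).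
  exists (rotate r c p); last by rewrite rotateK.
  rewrite mV rotate_in_rect // nU ?rotate_in_rect //= !leq_sub_rev //=.
  by apply: contra np => /eqP <-; rewrite rotateK.
have [x1 x2] := andP xR.
have adm t : adj x t -> in_rect r c t -> addable (x :: U) t.
  move=> axt tR; have := adj_le axt; rewrite -(nU _ tR) => ntU.
  rewrite /addable !inE negb_or (adj_neq axt) ntU /=.
  have H v : in_rect r c v -> (v.1 < x.1) || (v.2 < x.2) -> v \in U.
    by move=> vR l; rewrite -[_ \in _]negbK (nU _ vR) negb_and -!ltnNge.
  have [t1 t2] := andP tR.
  case/orP: axt t1 t2 => /eqP -> /= t1 t2; rewrite -?surjective_pairing ?eqxx ?orbT ?andbT /=.
    case: (posnP x.1) => //= xp; rewrite H ?orbT //= /in_rect /= ?t2 ?ltn_predL ?xp //.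
    by rewrite (leq_ltn_trans (leq_pred _)).
  case: (posnP x.2) => //= xp; rewrite H ?orbT //= /in_rect /= ?t1 ?ltn_predL ?xp ?orbT //.
  by rewrite (leq_ltn_trans (leq_pred _)).
(* [Delta L] fills a rectangle without its last cell. The corner of [L] is addable to it, hence is
   that cell or lies just past the first row or first column; the neighbours of [x] on the right and
   below exclude the last two through descents. *)
have := Delta_valid vL; rewrite valid_rcons cats0 => /andP[_ /and3P[nf uf lf]].
have ear : x.2.+1 < c -> content_lt (rotate r c (rt x)) (corner L).
  move=> xc; have art : adj x (rt x) by rewrite /adj eqxx.
  have rR : in_rect r c (rt x) by rewrite /in_rect /= x1.
  by rewrite (evac_corner_adj art rR (adm _ art rR)) /content_lt /= addSn ltnSn.
have ead : x.1.+1 < r -> ~~ content_lt (rotate r c (dn x)) (corner L).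
  move=> xr; have art : adj x (dn x) by rewrite /adj eqxx orbT.
  have rR : in_rect r c (dn x) by rewrite /in_rect /= xr.
  by rewrite (evac_corner_adj art rR (adm _ art rR)) /content_lt /= addnS -leqNgt leqnSn.
move: nf uf lf ear ead; rewrite !mD; case: (corner L) => f1 f2.
rewrite /rotate /content_lt /= -!predn_sub !subnS => nf uf lf ear ead.
have [||||-> -> //] := rect_corner _ _ nf uf lf; rewrite ?subn_gt0 //.
- by move=> b1; apply: ear; rewrite -subn_gt0 subnS; case: (c - x.2) b1 => [|[]].
- by move=> a1; apply: ead; rewrite -subn_gt0 subnS; case: (r - x.1) a1 => [|[]].
Qed.

End EvacStep.

(** Downward induction on [j]: nothing is left at [j = size s], and each step back adds the corner
    found by [evac_corner]. *)
Lemma evac_perm r c s j : full r c s -> j <= size s ->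
  perm_eq (iter j Delta s) (map (rotate r c) (drop j s)).
Proof.
move: {2}(size s - j) (leqnn (size s - j)) => m.
elim: m s j => [|m IH] s j le fs js.
  have e : j = size s by lia.
  rewrite e drop_size /= (_ : iter _ _ _ = [::]) //.
  by apply/eqP; rewrite -size_eq0 size_iter_Delta subnn.
have [e|lt] := leqP (size s) j.
  apply: IH => //; lia.
have es : s = take j s ++ nth (0, 0) s j :: drop j.+1 s by rewrite -drop_nth // cat_take_drop.
have sz t : full r c t -> size t = size s.
  by move=> /andP[_ /perm_size ->]; case/andP: fs => _ /perm_size ->.
have H t i : full r c t -> j < i -> i <= size t -> perm_eq (iter i Delta t) (map (rotate r c) (drop i t)).
  by move=> ft ji it; apply: IH => //; rewrite (sz _ ft) in it *; lia.
have := evac_corner fs H es (size_takel js) erefl => ec.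
have nL : iter j Delta s != [::] by rewrite -size_eq0 size_iter_Delta; lia.
have := Delta_perm nL; rewrite perm_sym ec => p; apply: (perm_trans p).
rewrite perm_rcons (drop_nth (0, 0)) //= perm_cons -iterS.
exact: H.
Qed.

Lemma evac_corner_rotate r c s j : full r c s -> j < size s ->
  corner (iter j Delta s) = rotate r c (nth (0, 0) s j).
Proof.
move=> fs js; apply: (@corner_eq _ _ (map (rotate r c) (drop j.+1 s))).
- by rewrite -size_eq0 size_iter_Delta; lia.
- by have := evac_perm fs (ltnW js); rewrite (drop_nth (0, 0)).
- exact: (evac_perm fs js).
Qed.

(** * Stacked tableaux *)

(** Gromotion on cell lists: the vacated corner receives the new largest entry. *)
Definition promote (s : seq cell) := if s is a :: s' then rcons (outs a s') (hole a s') else [::].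

Lemma promote_full r c s : full r c s -> full r c (promote s).
Proof.
case: s => // a s /andP[v p]; rewrite /full slide_valid //=.
exact: perm_trans (slide_perm a s) p.
Qed.

Definition col_height (D : seq cell) k := count (fun x => x.2 == k) D.
Definition lower_by (h : nat -> nat) (q : seq cell) : seq cell := [seq (x.1 + h x.2, x.2) | x <- q].

Lemma mem_col_height D i k : valid [::] D -> ((i, k) \in D) = (i < col_height D k).
Proof.
elim/last_ind: D i k => // D x IH i k; rewrite valid_rcons cats0 => /andP[v ax].
rewrite mem_rcons inE /col_height -cats1 count_cat /= addn0 -/(col_height D k) IH //.
case/and3P: ax => nx ux _; case: x nx ux => a b /=.
rewrite !IH // xpair_eqE; case: (eqVneq b k) => [ebk|nbk] /= nx ux.
  by subst b; rewrite ?eqxx ?andbT; lia.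
by lia.
Qed.

(* The hole stays in column [k]: the entry below it is smaller than the one on its right,
   because column [k.+1] sits at least one row higher. *)
Lemma slide_lower_by f k h v1 v2 : h k = f.+1 -> h k.+1 <= f -> valid [::] (v1 ++ v2) ->
  outs (f + col_height v1 k, k) (lower_by h v2) = lower_by (fun x => h x - (x == k)) v2 /\
  hole (f + col_height v1 k, k) (lower_by h v2) = (f + col_height (v1 ++ v2) k, k).
Proof.
move=> hk hk1; elim: v2 v1 => [|[i k'] v2 IH] v1 v; first by rewrite cats0.
have v' : valid [::] (rcons v1 (i, k') ++ v2) by rewrite cat_rcons.
have [] := IH _ v'.
have -> : col_height (rcons v1 (i, k')) k = col_height v1 k + (k' == k).
  by rewrite /col_height -cats1 count_cat /= addn0.
rewrite cat_rcons => e1 e2.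
have [v0 /and3P[ni ui li]] : valid [::] v1 /\ addable v1 (i, k').
  by move: v; rewrite valid_cat cats0 /= => /and3P[].
rewrite /= !mem_col_height // in ni ui li.
rewrite /= /adj /rt /dn /= !xpair_eqE.
have [ek|nk] := eqVneq k' k.
  rewrite ek eqxx addn1 addnS /= in e1 e2 *; rewrite ek in ni ui.
  have ei : i = col_height v1 k by lia.
  have -> : (i + h k == (f + col_height v1 k).+1) by lia.
  rewrite /= orbT; have -> : i + h k = (f + col_height v1 k).+1 by lia.
  rewrite e1 e2; split => //; congr ((_, _) :: _); lia.
rewrite (negPf nk) addn0 in e1 e2.
(* A cell of column [k.+1] to the right of the hole would have [i >= col_height v1 k], while its
   left neighbour must already be in [v1]. *)
have -> : (i + h k' == f + col_height v1 k) && (k' == k.+1) = false.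
  by apply/negbTE/negP => /andP[/eqP e /eqP ek]; rewrite ek /= in ni ui li e; lia.
by rewrite andbF /= e1 e2 subn0.
Qed.

Lemma corner_col_height s : valid [::] s -> s != [::] ->
  col_height s (corner s).2 = (corner s).1.+1 /\ col_height s (corner s).2.+1 <= (corner s).1.
Proof.
move=> v n; have v' := Delta_valid v; have p := Delta_perm n.
have ec k : col_height s k = col_height (Delta s) k + ((corner s).2 == k).
  by rewrite /col_height -(permP p) -cats1 count_cat /= addn0.
rewrite !ec; move: v'; rewrite valid_rcons cats0 => /andP[v1].
case: (corner s) => a b /and3P[] /=.
have := @valid0_ideal _ v1 (a, b.+1); rewrite !mem_col_height // => /[swap] na.
move=> /(_ _ (a, b)) /=; rewrite mem_col_height // => i ui _; split; first by rewrite eqxx; lia.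
by have := i; rewrite leqnn leqnSn; lia.
Qed.

Lemma col_height_Delta s : s != [::] ->
  col_height (Delta s) =1 (fun k => col_height s k - (k == (corner s).2)).
Proof.
move=> n k; rewrite /col_height -(permP (Delta_perm n)) -cats1 count_cat /= addn0 eq_sym; lia.
Qed.

Lemma eq_lower_by h h' q : h =1 h' -> lower_by h q = lower_by h' q.
Proof. by move=> e; apply: eq_map => x; rewrite e. Qed.

(** The hole leaves [P] at the foot of a column and pulls up that column of [q], which matches the
    loss of one cell in this column of [P]. The entries behind [q] need no description. *)
Lemma promote_stack P q N : valid [::] P -> P != [::] -> valid [::] q ->
  exists N', promote (P ++ lower_by (col_height P) q ++ N) = Delta P ++ lower_by (col_height (Delta P)) q ++ N'.
Proof.
move=> v n vq; have [c1 c2] := corner_col_height v n.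
have := @slide_lower_by _ _ _ [::] q c1 c2 vq; rewrite addn0 -surjective_pairing.
rewrite (eq_lower_by q (col_height_Delta n)); case: P v n c1 c2 => // a P _ _ _ _ /= [e1 e2].
rewrite !outs_cat e1; eexists; rewrite -!cats1 -!catA; reflexivity.
Qed.

Lemma iter_promote_stack r c p q j : full r c p -> full r c q -> j <= r * c ->
  exists N, iter j promote (p ++ lower_by (col_height p) q) =
    iter j Delta p ++ lower_by (col_height (iter j Delta p)) q ++ N.
Proof.
move=> fp fq; have sp : size p = r * c by case/andP: fp => _ /perm_size ->; rewrite size_rect_cells.
elim: j => [|j IH] jn; first by exists [::]; rewrite cats0.
have [N /= ->] := IH (ltnW jn); apply: promote_stack.
- by apply: iter_Delta_valid; case/andP: fp.
- by rewrite -size_eq0 size_iter_Delta sp subn_eq0 -ltnNge.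
- by case/andP: fq.
Qed.

(** With [(i, k')] the cell of the deleted entry in [p], the hole leaves [P] in column
    [k = c.-1 - k'] at row [r.-1 - i]. That column has height [r - i], so the cell of [q] now in row
    [r] is the one in row [i]. Before it come the remaining cells of [P] and the cells of [q]
    preceding [z]. *)
Lemma stack_cross r c p q j : full r c p -> full r c q -> j < r * c ->
  let z := ((nth (0, 0) p j).1, c.-1 - (nth (0, 0) p j).2) in
  exists a u B, [/\ iter j promote (p ++ lower_by (col_height p) q) = a :: u ++ (r, z.2) :: B,
    hole a u = (r.-1, z.2) & size u = (r * c - j).-1 + index z q].
Proof.
move=> fp fq jn.
have sp : size p = r * c by case/andP: fp => _ /perm_size ->; rewrite size_rect_cells.
have : in_rect r c (nth (0, 0) p j) by rewrite -(full_mem _ fp) mem_nth // sp.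
have [N ->] := iter_promote_stack fp fq (ltnW jn).
have := evac_corner_rotate fp; rewrite sp => /(_ _ jn).
set P := iter j Delta p; case: (nth (0, 0) p j) => i k'; rewrite /rotate /= => cP.
rewrite /in_rect /= => /andP[ir kc]; set k := c.-1 - k' in cP *.
have vP : valid [::] P by apply: iter_Delta_valid; case/andP: fp.
have sP : size P = r * c - j by rewrite size_iter_Delta sp.
have nP : P != [::] by rewrite -size_eq0 sP subn_eq0 -ltnNge.
have [c1 c2] := corner_col_height vP nP; rewrite cP /= in c1 c2.
have zq : (i, k) \in q by rewrite (full_mem _ fq) /in_rect /= ir /k; lia.
have uq : uniq q by case/andP: fq => /valid0_uniq.
have vq : valid [::] q by case/andP: fq.
move: vq; rewrite -{1}(cat_take_drop (index (i, k) q) q) (drop_nth (0, 0)) ?index_mem // nth_index // => vq.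
have v1 := valid_catl vq.
have ei : i = col_height (take (index (i, k) q) q) k.
  move: vq; rewrite valid_cat cats0 /= => /and3P[_ /and3P[/= + + _] _].
  rewrite !mem_col_height //; lia.
have [_] := @slide_lower_by _ _ _ [::] _ c1 c2 v1; rewrite addn0 /= -ei.
have ec1 : col_height P k = r - i by rewrite c1; lia.
move=> e.
have -> : lower_by (col_height P) q = lower_by (col_height P) (take (index (i, k) q) q) ++
    (r, k) :: lower_by (col_height P) (drop (index (i, k) q).+1 q).
  rewrite -{1}(cat_take_drop (index (i, k) q) q) (drop_nth (0, 0)) ?index_mem // nth_index //.
  by rewrite /lower_by map_cat map_cons /= ec1 subnKC // ltnW.
move: e; set u1 := lower_by _ (take _ _); set u2 := lower_by _ _ => e.
have su : size u1 = index (i, k) q by rewrite size_map size_takel // ltnW // index_mem.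
clearbody P u1 u2; case: P nP cP sP {vP c1 c2 ec1} => // a P _ cP sP.
exists a, (P ++ u1), (u2 ++ N); split.
- by rewrite /= -!catA.
- by rewrite hole_cat -[hole a P]/(corner (a :: P)) cP e -/k; congr pair; lia.
- by rewrite -sP /= size_cat su.
Qed.

(** * Gromotion as a slide *)

Lemma entry_set T p x q : entry (set_entry T p x) q = if q == p then x else entry T q.
Proof.
case: p q => [i j] [i' j']; rewrite /entry /set_entry /= nth_set_nth /= xpair_eqE.
by case: (eqVneq i' i) => [->|] //=; rewrite nth_set_nth /=; case: ifP.
Qed.

Lemma map_entry_set T p x (s : seq cell) : p \notin s ->
  map (entry (set_entry T p x)) s = map (entry T) s.
Proof.
by move=> np; apply/eq_in_map => q qs; rewrite entry_set; case: eqP np => // <-; rewrite qs.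
Qed.

(** [x] holds the smallest entry still to be visited. Another neighbour of the hole holds a larger
    one: it cannot be in the ideal [o], which would then contain [p]. *)
Lemma next_cell_adj R c T o p x u e : full R c (o ++ [:: p, x & u]) ->
  map (entry T) (x :: u) = iota e (size u).+1 -> adj p x -> next_cell R c T p = x.
Proof.
move=> f eq ax.
have pR : in_rect R c p by rewrite -(full_mem _ f) mem_cat mem_head orbT.
have xR : in_rect R c x by rewrite -(full_mem _ f) mem_cat !inE eqxx !orbT.
have [v _] := andP f.
have nu := valid0_uniq v.
have io : ideal o by apply: valid0_ideal; apply: valid_catl v.
have H q : adj p q -> q != x -> in_rect R c q -> e < entry T q.
  move=> aq nqx; rewrite -(full_mem _ f) mem_cat !inE (negPf nqx) /=.
  rewrite (negPf (adj_neq aq)) /=.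
  case/orP => [qo|qu].
    suff po : p \in o by move: nu; rewrite cat_uniq /= po /= andbF.
    by apply: (io _ qo); case/orP: aq => /eqP -> /=.
  case: eq => _ eu; have : entry T q \in iota e.+1 (size u) by rewrite -eu map_f.
  by rewrite mem_iota => /andP[].
have ex : entry T x = e by case: eq.
case: p x ax pR xR f v nu H ex {eq} => i j [i' j']; rewrite /in_rect /= => ax /andP[iR jc] /andP[i'R j'c] _ _ _ H ex.
case/orP: ax => /eqP e'; move: (e') => -[e1 e2]; subst i' j'; rewrite /= ?i'R ?j'c.
- case: ifP => // iR'; have K : e < entry T (i.+1, j).
    by apply: H; rewrite /adj ?eqxx ?orbT ?xpair_eqE ?iR' //=; lia.
  by rewrite ex ltnNge ltnW.
- case: ifP => // jc'; have K : e < entry T (i, j.+1).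
    by apply: H; rewrite /adj ?eqxx ?orbT ?xpair_eqE ?iR //=; lia.
  by rewrite ex K.
Qed.

(** [o] lists the cells already settled, [u1] those to be passed, [u2] the rest. The number [k] of
    actual moves is smaller than [size u1] in general; each move raises row plus column by one,
    which determines it. *)
Lemma slide_run R c m o p u1 u2 T : full R c (o ++ p :: u1 ++ u2) ->
  map (entry T) o = iota m.+1 (size o) ->
  map (entry T) (u1 ++ u2) = iota (m.+1 + size o) (size (u1 ++ u2)) ->
  exists T' k, [/\ iter k (slide_step R c) (T, p) = (T', hole p u1),
    k + (p.1 + p.2) = (hole p u1).1 + (hole p u1).2,
    map (entry T') (o ++ outs p u1) = iota m.+1 (size o + size u1) &
    map (entry T') u2 = iota (m.+1 + size o + size u1) (size u2)].
Proof.
elim: u1 o p T => [|x u1 IH] o p T f eo eu.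
  by exists T, 0; rewrite /= cats0 addn0 addn0.
have [v pm] := andP f.
have nu := valid0_uniq v.
have [xp|nxp] := boolP (adj p x).
  have nx := next_cell_adj f eu xp.
  have pno : p \notin o.
    by move: nu; rewrite cat_uniq => /and3P[_ /hasPn /(_ p) /= + _]; rewrite mem_head => /(_ isT).
  have pnu : p \notin u1 ++ u2.
    by move: nu; rewrite cat_uniq => /and3P[_ _] /= /andP[]; rewrite inE negb_or => /andP[].
  have ex : entry T x = m.+1 + size o by case: eu.
  pose T1 := set_entry T p (entry T x).
  have [|||T' [k [i1 i2 i3 i4]]] := IH (rcons o p) x T1.
  - by rewrite cat_rcons.
  - rewrite map_rcons size_rcons map_entry_set // eo entry_set eqxx ex.
    by rewrite -cats1 -[(size o).+1]addn1 iotaD.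
  - by rewrite map_entry_set // size_rcons addnS; case: eu.
  have st : slide_step R c (T, p) = (T1, x) by rewrite /slide_step /= nx.
  exists T', k.+1; rewrite iterSr st [hole _ _]/= [outs _ _]/= xp.
  rewrite cat_rcons size_rcons in i3; rewrite size_rcons in i4.
  split => //; last 2 first.
  - by rewrite i3 addSnnS.
  - by rewrite i4; congr iota => /=; lia.
  by case/orP: xp i2 => /eqP -> /=; lia.
(* The hole does not move: only its place in the list is exchanged with [x]. *)
have [|||T' [k [i1 i2 i3 i4]]] := IH (rcons o x) p T.
- rewrite cat_rcons /full in f *; case/andP: f => v' p'; apply/andP; split.
    by rewrite !valid_cat in v' *; case/andP: v' => -> /valid_swap ->.
  apply: perm_trans p'; rewrite perm_cat2l.
  by rewrite -[X in perm_eq X _]/([:: x] ++ [:: p] ++ (u1 ++ u2)) perm_catCA.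
- by rewrite map_rcons size_rcons eo -cats1 -[(size o).+1]addn1 iotaD; case: eu => ->.
- by rewrite size_rcons addnS; case: eu.
exists T', k; rewrite /= (negPf nxp).
rewrite cat_rcons size_rcons in i3; rewrite size_rcons in i4.
split => //.
- by rewrite i3 addSnnS.
- by rewrite i4; congr iota => /=; lia.
Qed.

Definition reads R c m (T : tableau) s := full R c s /\ map (entry T) s = iota m (R * c).

Lemma full_size_eq R c s : full R c s -> size s = R * c.
Proof. by case/andP => _ /perm_size ->; rewrite size_rect_cells. Qed.

Lemma full_head R c a s : full R c (a :: s) -> a = (0, 0).
Proof. by case/andP => /= /andP[/addable_nil]. Qed.

Lemma full_last R c s x : full R c (rcons s x) -> x = (R.-1, c.-1).
Proof.
move=> f; have [v _] := andP f.
have xR : in_rect R c x by rewrite -(full_mem _ f) mem_rcons mem_head.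
have : (R.-1, c.-1) \in rcons s x by rewrite (full_mem _ f) /in_rect /=; move: xR => /andP[]; lia.
rewrite mem_rcons inE => /orP[/eqP //|ms].
move: v; rewrite valid_rcons cats0 => /andP[/valid0_ideal vi /and3P[/negP nx _ _]].
by case: nx; apply: vi ms _ _ _; move: xR => /andP[] /=; lia.
Qed.

Lemma slide_states_last R c T x : last x (slide_states R c T) =
  iter (R.-1 + c.-1) (slide_step R c) (T, (0, 0)).
Proof. by rewrite /slide_states trajectSr last_rcons. Qed.

Lemma gromotion_reads R c m T s : s != [::] -> reads R c m T s ->
  reads R c m.+1 (gromotion R c T) (promote s).
Proof.
case: s => // a s _ [f e].
have ea := full_head f; have sz := full_size_eq f.
have [|||T' [k [i1 i2 i3 _]]] := @slide_run R c m [::] a s [::] T.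
- by rewrite cats0.
- by [].
- by rewrite cats0 addn0; rewrite -sz in e; case: e.
have fp := promote_full f; have hl := full_last fp.
split => //; rewrite /gromotion slide_states_last.
(* From the origin to the bottom-right corner, the run takes exactly the prescribed number of
   moves. *)
have -> : R.-1 + c.-1 = k by rewrite hl ea /= in i2; lia.
rewrite -ea i1 /= map_rcons entry_set hl eqxx map_entry_set; last first.
  have [/valid0_uniq] := andP fp; rewrite /= rcons_uniq -hl => /andP[] //.
have szs : R * c = size s + 1 by rewrite -sz /= addn1.
rewrite /= add0n in i3; rewrite i3 szs iotaD -cats1.
have -> : entry T a = m by rewrite -sz in e; case: e.
by rewrite addn1 addSnnS.
Qed.

Lemma iter_gromotion_reads R c m T s j : s != [::] -> reads R c m T s ->
  reads R c (m + j) (iter j (gromotion R c) T) (iter j promote s).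
Proof.
move=> n rd; elim: j => [|j IH]; first by rewrite addn0.
rewrite addnS /=; apply: gromotion_reads => //.
have [f _] := IH; have [f' _] := rd.
by move: n; rewrite -!size_eq0 (full_size_eq f) (full_size_eq f').
Qed.

Lemma next_cell_row R c T p : p.1 <= (next_cell R c T p).1.
Proof. by case: p => i j; rewrite /next_cell; do !case: ifP => _. Qed.

Lemma slide_row R c s k d : (iter k (slide_step R c) s).2.1 <= (iter (d + k) (slide_step R c) s).2.1.
Proof. by elim: d => // d IH; apply: leq_trans IH _; apply: next_cell_row. Qed.

Lemma find_first (T : Type) (P : pred T) x0 s k : k < size s -> P (nth x0 s k) ->
  (forall i, i < k -> ~~ P (nth x0 s i)) -> find P s = k.
Proof.
move=> ks Pk nP; apply/eqP; rewrite eqn_leq; apply/andP; split.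
  by rewrite leqNgt; apply/negP => /(before_find x0); rewrite Pk.
rewrite leqNgt; apply/negP => lt; have hs : has P s by rewrite has_find; lia.
by have := nP _ lt; rewrite nth_find.
Qed.

(** After [u] the hole is directly above [(i, k)], whose entry comes next in order and therefore
    slides up. Row [i] counted from 0 is the row below row [i] counted from 1. *)
Lemma slid_up_reads R c m T a u i k B : 0 < i ->
  reads R c m T (a :: u ++ (i, k) :: B) -> hole a u = (i.-1, k) ->
  slid_up R c i T = m.+1 + size u.
Proof.
move=> i0 [f e] eh; have sz := full_size_eq f; have ea := full_head f.
rewrite -sz in e; case: e => em e.
have [|||T' [t [i1 i2 i3 i4]]] := @slide_run R c m [::] a u ((i, k) :: B) T.
- by [].
- by [].
- by rewrite addn0.
rewrite eh ea /= addn0 in i1 i2 i3 i4.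
have xR : in_rect R c (i, k) by rewrite -(full_mem _ f) !(mem_cat, inE) eqxx !orbT.
have f' : full R c (outs a u ++ [:: (i.-1, k), (i, k) & B]).
  have [v pm] := andP f; rewrite /full -eh slide_valid_cat //=.
  apply: perm_trans pm.
  by have := slide_perm a u; rewrite -(perm_cat2r ((i, k) :: B)) cat_rcons.
have nx : next_cell R c T' (i.-1, k) = (i, k).
  apply: next_cell_adj f' i4 _; rewrite /adj /dn /= prednK // eqxx orbT //.
have i5 : iter t.+1 (slide_step R c) (T, (0, 0)) =
    (set_entry T' (i.-1, k) (entry T' (i, k)), (i, k)).
  by rewrite iterS i1 /slide_step nx.
have tl : t.+1 < (R.-1 + c.-1).+1 by move: xR i2; rewrite /in_rect /=; lia.
rewrite /slid_up (@find_first _ _ (T, (0, 0)) _ t.+1).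
- rewrite nth_traject // i5 /= entry_set eqxx; by case: i4 => -> _; rewrite addn0.
- by rewrite size_traject.
- by rewrite nth_traject // i5 /=.
(* The row of the empty cell never decreases, so no earlier state has reached row [i]. *)
move=> l lt; rewrite nth_traject ?(ltn_trans lt) //.
have := slide_row R c (T, (0, 0)) l (t - l); rewrite subnK // i1 /=.
by move=> le; apply/negP => /eqP el; move: le; rewrite el; lia.
Qed.

(** * Standard tableaux and their stacks as cell lists *)

Lemma SYT_size R c T : SYT R c T -> size T = R.
Proof. by case/and4P => /eqP/(congr1 size); rewrite size_map size_nseq. Qed.

Lemma SYT_row R c T i : SYT R c T -> i < R -> size (nth [::] T i) = c.
Proof.
move=> st iR; have := SYT_size st; case/and4P: st => /eqP/(congr1 (fun s => nth 0 s i)) + _ _ _.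
by move=> + sT; rewrite nth_nseq iR (nth_map [::]) // sT.
Qed.

Lemma SYT_right R c T i k : SYT R c T -> i < R -> k.+1 < c -> entry T (i, k) < entry T (i, k.+1).
Proof.
move=> st iR kc; have sr := SYT_row st iR; have sT := SYT_size st.
case/and4P: st => _ /(all_nthP [::])/(_ i) + _ _; rewrite sT => /(_ iR) so.
by have /(_ k) := sortedP 0 so; rewrite sr; apply.
Qed.

Lemma nth_transpose R c T i k : size T = R -> i < R -> k < c ->
  nth 0 (nth [::] (transpose c T) k) i = entry T (i, k).
Proof.
move=> sT iR kc; rewrite /transpose (nth_map 0) ?size_iota // nth_iota // add0n.
by rewrite (nth_map [::]) ?sT.
Qed.

Lemma size_transpose_row R c T k : size T = R -> k < c -> size (nth [::] (transpose c T) k) = R.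
Proof.
by move=> sT kc; rewrite /transpose (nth_map 0) ?size_iota // size_map.
Qed.

Lemma SYT_down R c T i k : SYT R c T -> i.+1 < R -> k < c -> entry T (i, k) < entry T (i.+1, k).
Proof.
move=> st iR kc; have sT := SYT_size st.
case/and4P: st => _ _ /(all_nthP [::])/(_ k) + _; rewrite size_map size_iota => /(_ kc) so.
have /(_ i) := sortedP 0 so; rewrite (size_transpose_row sT kc) => /(_ iR).
by rewrite !(nth_transpose sT) // ltnW.
Qed.

Lemma map_entry_rect_cells R c T : SYT R c T -> map (entry T) (rect_cells R c) = flatten T.
Proof.
move=> st; have sT := SYT_size st.
rewrite /rect_cells map_flatten -map_comp; congr flatten.
apply: (@eq_from_nth _ [::]); first by rewrite size_map size_iota sT.
move=> i; rewrite size_map size_iota => iR; rewrite (nth_map 0) ?size_iota // nth_iota //= add0n.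
have sr := SYT_row st iR; rewrite -map_comp; apply: (@eq_from_nth _ 0); first by rewrite size_map size_iota sr.
by move=> k; rewrite size_map size_iota => kc; rewrite (nth_map 0) ?size_iota // nth_iota.
Qed.

Lemma valid_of_addable s : (forall n, n < size s -> addable (take n s) (nth (0, 0) s n)) -> valid [::] s.
Proof.
move=> H; suff K n : n <= size s -> valid [::] (take n s) by rewrite -[s]take_size K.
elim: n => [|n IH] ns; first by rewrite take0.
by rewrite (take_nth (0, 0)) // valid_rcons cats0 IH ?H // ltnW.
Qed.

Lemma SYT_reads R c T : SYT R c T -> exists s, reads R c 1 T s.
Proof.
move=> st; pose s := sort (relpre (entry T) leq) (rect_cells R c).
have ps : perm_eq s (rect_cells R c) by rewrite perm_sort.
have es : map (entry T) s = iota 1 (R * c).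
  rewrite -sort_map map_entry_rect_cells //; case/and4P: (st) => _ _ _ pT.
  have /perm_sortP -> := pT => //.
  - by rewrite sorted_sort ?iota_sorted //; apply: leq_trans.
  - exact: leq_total.
  - exact: leq_trans.
  - exact: anti_leq.
have sz : size s = R * c by rewrite (perm_size ps) size_rect_cells.
have us : uniq s by rewrite (perm_uniq ps) rect_cells_uniq.
have en n : n < size s -> entry T (nth (0, 0) s n) = n.+1.
  by move=> ns; rewrite -(nth_map _ 0) // es nth_iota -?sz.
(* Cells with smaller entries come earlier in the sorted list. *)
have mt n y : n < size s -> in_rect R c y -> entry T y < n.+1 -> y \in take n s.
  move=> ns yR ly; have ys : y \in s by rewrite (perm_mem ps) mem_rect_cells.
  rewrite -(nth_index (0, 0) ys) in ly *; rewrite en ?index_mem // in ly.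
  by rewrite -(@nth_take n) // mem_nth // size_take ns.
exists s; split=> //; rewrite /full ps andbT; apply: valid_of_addable => n ns.
have xR : in_rect R c (nth (0, 0) s n) by rewrite -mem_rect_cells -(perm_mem ps) mem_nth.
have H := en n ns; apply/and3P; split.
- by rewrite in_take_leq ?mem_nth ?index_uniq ?ltnn // ltnW.
- move: H xR; case: (nth (0, 0) s n) => -[|i] k //= en' /andP[/= iR kc].
  by apply: mt; rewrite // -?en' ?(SYT_down st) // /in_rect /= kc ltnW.
- move: H xR; case: (nth (0, 0) s n) => i [|k] //= en' /andP[/= iR kc].
  by apply: mt; rewrite // -?en' ?(SYT_right st) // /in_rect /= iR ltnW.
Qed.

Lemma entry_stack_top r c P Q i k : SYT r c P -> i < r -> entry (stack (r * c) P Q) (i, k) = entry P (i, k).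
Proof. by move=> st ir; rewrite /entry /stack /= nth_cat (SYT_size st) ir. Qed.

Lemma entry_stack_bot r c P Q i k : SYT r c P -> SYT r c Q -> i < r -> k < c ->
  entry (stack (r * c) P Q) (i + r, k) = entry Q (i, k) + r * c.
Proof.
move=> st sq ir kc; rewrite /entry /stack /= nth_cat (SYT_size st) ltnNge leq_addl /= addnK.
by rewrite (nth_map [::]) ?(SYT_size sq) // (nth_map 0) // (SYT_row sq).
Qed.

Definition lower r (x : cell) : cell := (x.1 + r, x.2).

Lemma valid_lower r c p D v : 0 < r -> full r c p -> {in D ++ v, forall x, in_rect r c x} ->
  valid D v -> valid (map (lower r) D ++ p) (map (lower r) v).
Proof.
move=> r0 fp; elim: v D => //= x v IH D inD /andP[ax vv]; apply/andP; split.
  case/and3P: ax => nx ux lx.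
  have xR : in_rect r c x by apply: inD; rewrite mem_cat mem_head orbT.
  have li : injective (lower r) by case=> a b [a' b'] [] /addIn -> ->.
  rewrite /addable !mem_cat mem_map // negb_or nx !(full_mem _ fp) /in_rect /=.
  have -> /= : (x.1 + r < r) = false by lia.
  move: xR => /andP[x1 x2]; apply/andP; split.
    case/orP: ux => [/eqP e|ux].
      by rewrite e add0n prednK // leqnn x2 !orbT.
    have [e|n0] := eqVneq x.1 0; first by rewrite e add0n prednK // leqnn x2 !orbT.
    have -> : ((x.1 + r).-1, x.2) = lower r (x.1.-1, x.2) by rewrite /lower /=; congr pair; lia.
    by rewrite mem_map // ux !orbT.
  case/orP: lx => [->//|lx].
  have -> : (x.1 + r, x.2.-1) = lower r (x.1, x.2.-1) by [].
  by rewrite mem_map // lx !orbT.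
rewrite -(eq_valid _ (D := map (lower r) (x :: D) ++ p)) //.
apply: IH => // y; rewrite mem_cat inE => yy; apply: inD; rewrite mem_cat inE.
by case/orP: yy => [/orP[]|] ->; rewrite ?orbT.
Qed.

Lemma lower_by_col_height r c p q : full r c p -> full r c q -> lower_by (col_height p) q = map (lower r) q.
Proof.
move=> fp fq; apply/eq_in_map => -[i k]; rewrite (full_mem _ fq) => /andP[/= ir kc].
have [v _] := andP fp; congr pair => /=; congr addn.
have := mem_col_height r k v; have := mem_col_height r.-1 k v; rewrite !(full_mem _ fp) /in_rect /= kc; lia.
Qed.

Lemma stack_reads r c P Q p q : SYT r c P -> SYT r c Q -> 0 < r ->
  reads r c 1 P p -> reads r c 1 Q q ->
  reads (2 * r) c 1 (stack (r * c) P Q) (p ++ lower_by (col_height p) q).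
Proof.
move=> st sq r0 [fp ep] [fq eq]; rewrite (lower_by_col_height fp fq).
have [vp _] := andP fp; have [vq _] := andP fq.
split.
  apply: fullP.
    rewrite valid_cat vp cats0; have := @valid_lower r c p [::] q r0 fp; apply=> // x.
    by rewrite (full_mem _ fq).
  case=> i k; rewrite mem_cat (full_mem _ fp) /in_rect /=.
  have [ir|ri] := ltnP i r => /=.
    have -> : i < 2 * r by lia.
    case: (k < c) => //=; apply/negbTE/negP => /mapP[[a b] _ [e _]]; lia.
  apply/mapP/andP => [[[a b]]|[i2 kc]].
    by rewrite (full_mem _ fq) /in_rect /= => /andP[ar bc] [-> ->]; split => //; lia.
  exists (i - r, k); first by rewrite (full_mem _ fq) /in_rect /= kc; lia.
  by rewrite /lower /= subnK.
rewrite map_cat; have -> : map (entry (stack (r * c) P Q)) p = map (entry P) p.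
  by apply/eq_in_map => -[i k]; rewrite (full_mem _ fp) => /andP[/= ir kc]; rewrite (entry_stack_top _ _ st).
have -> : map (entry (stack (r * c) P Q)) (map (lower r) q) = map (fun x => x + r * c) (map (entry Q) q).
  rewrite -!map_comp; apply/eq_in_map => -[i k]; rewrite (full_mem _ fq) => /andP[/= ir kc].
  by rewrite /lower /= (entry_stack_bot st sq).
rewrite ep eq -mulnA mul2n -addnn iotaD; congr cat.
by rewrite addnC iotaDl; apply: eq_map => x; rewrite addnC.
Qed.

Lemma prom_stack r c P Q p q : 0 < r -> SYT r c P -> SYT r c Q ->
  reads r c 1 P p -> reads r c 1 Q q ->
  [seq x - r * c | x <- take (r * c) (prom (2 * r) c r (stack (r * c) P Q))] =
  [seq entry Q (x.1, c.-1 - x.2) | x <- p].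
Proof.
move=> r0 st sq rp rq; have rs := stack_reads st sq r0 rp rq.
have [fp ep] := rp; have [fq eq] := rq.
have sp := full_size_eq fp; have sQ := full_size_eq fq.
rewrite /prom -map_take take_iota (minn_idPl _); last by lia.
apply: (@eq_from_nth _ 0); first by rewrite !size_map size_iota sp.
move=> j; rewrite !size_map size_iota => jn.
rewrite (nth_map 0) ?size_map ?size_iota // (nth_map 0) ?size_iota // nth_iota //.
rewrite (nth_map (0, 0)) ?sp //.
have [a [u [B [eit eh su]]]] := stack_cross fp fq jn.
have nz : p ++ lower_by (col_height p) q != [::] by rewrite -size_eq0 size_cat sp; lia.
have := iter_gromotion_reads j nz rs; rewrite eit => rj.
(* The crossing entry is [j + 2 + (r * c - j).-1 + index z q], that is [r * c + entry Q z]. It is at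
   most [2 * r * c], so the reduction leaves it unchanged. *)
rewrite [(1 + j).-1]/= (slid_up_reads r0 rj eh) su.
have zR : in_rect r c ((nth (0, 0) p j).1, c.-1 - (nth (0, 0) p j).2).
  by have : nth (0, 0) p j \in p by [apply: mem_nth; rewrite sp]; rewrite (full_mem _ fp) /in_rect /=; lia.
rewrite -(full_mem _ fq) in zR; set z := (_, _) in zR *.
have ez : entry Q z = (index z q).+1.
  by rewrite -{1}(nth_index (0, 0) zR) -(nth_map _ 0) ?index_mem // eq nth_iota // -sQ index_mem.
have iz : index z q < r * c by rewrite -sQ index_mem.
by rewrite ez /residue1 modn_small; lia.
Qed.

(** * Injectivity of Robinson-Schensted *)

Lemma row_insert_le x T : (row_insert x T).2 <= size T.
Proof.
elim: T x => //= row T IH x; case: ifP => // _.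
by have := IH (nth 0 row (find (fun y => x < y) row)); case: row_insert.
Qed.

Lemma row_insert_shape x T : shape (row_insert x T).1 = incr_nth (shape T) (row_insert x T).2.
Proof.
elim: T x => //= row T IH x; case: ifP => [lt|_] /=; last by rewrite size_rcons.
have := IH (nth 0 row (find (fun y => x < y) row)); case: row_insert => U i /= ->.
by rewrite size_set_nth (maxn_idPr lt).
Qed.

Lemma before_find_le x row k : k < find (fun y => x < y) row -> nth 0 row k <= x.
Proof. by move/(before_find 0) => /negbT; rewrite -leqNgt. Qed.

Lemma sorted_nth_le row i j : sorted leq row -> i <= j -> j < size row -> nth 0 row i <= nth 0 row j.
Proof.
move=> so ij js; have := sorted_leq_nth leq_trans leqnn 0 so.
by apply; rewrite ?inE //; lia.
Qed.

Lemma row_insert_sorted x T : all (sorted leq) T -> all (sorted leq) (row_insert x T).1.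
Proof.
elim: T x => //= row T IH x /andP[so sT]; case: ifP => lt /=; last first.
  rewrite sT andbT; apply/(sortedP 0) => i; rewrite size_rcons ltnS => ir.
  rewrite !nth_rcons ir; case: ltnP => ir'; first by apply: sorted_nth_le.
  have ei : i.+1 = size row by lia.
  rewrite ei eqxx; apply: before_find_le.
  by move: lt; rewrite ltnNge => /negbFE; lia.
have := IH (nth 0 row (find (fun y => x < y) row)) sT.
case: row_insert => U i /= -> ; rewrite andbT.
set k := find _ row in lt *.
have xk : x < nth 0 row k by apply: (@nth_find _ 0 (fun y => x < y)); rewrite has_find.
apply/(sortedP 0) => j; rewrite size_set_nth (maxn_idPr lt) => js.
rewrite !nth_set_nth /=.
case: (eqVneq j k) => [ej|nj].
  have -> : j.+1 == k = false by lia.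
  apply: leq_trans (ltnW xk) _; apply: sorted_nth_le => //; lia.
case: (eqVneq j.+1 k) => [ej|nj']; last by apply: sorted_nth_le.
by apply: before_find_le; rewrite -/k; lia.
Qed.

(** Reverse bumping: by induction the lower rows determine the bumped value, and the sorted first
    row determines where it stood. *)
Lemma row_insert_inj x x' T T' : shape T = shape T' ->
  all (sorted leq) T -> all (sorted leq) T' ->
  row_insert x T = row_insert x' T' -> x = x' /\ T = T'.
Proof.
elim: T T' x x' => [|row T IH] [|row' T'] x x' //=; first by move=> _ _ _ [].
case=> sr sT /andP[so soT] /andP[so' soT'].
set k := find _ row; set k' := find _ row'.
have xk : k < size row -> x < nth 0 row k.
  by move=> lt; apply: (@nth_find _ 0 (fun y => x < y)); rewrite has_find.
have xk' : k' < size row' -> x' < nth 0 row' k'.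
  by move=> lt; apply: (@nth_find _ 0 (fun y => x' < y)); rewrite has_find.
case: ifP => lt; case: ifP => lt'.
- case E: (row_insert (nth 0 row k) T) => [U i].
  case E': (row_insert (nth 0 row' k') T') => [U' i'] [eN eU ei].
  have [||| ey eT] := IH T' (nth 0 row k) (nth 0 row' k') sT => //.
    by rewrite E E' eU ei.
  have N j : (if j == k then x else nth 0 row j) = (if j == k' then x' else nth 0 row' j).
    by have := congr1 (fun s => nth 0 s j) eN; rewrite !nth_set_nth.
  (* If the positions differed, one of the old rows would have the bumped value to the left of the
     smaller inserted value. *)
  have ekk : k = k'.
    apply/eqP; rewrite eqn_leq; apply/andP; split; rewrite leqNgt; apply/negP => l.
      have := N k; rewrite eqxx; have -> : k == k' = false by lia.
      move=> e; have := sorted_nth_le so' (ltnW l); rewrite -sr => /(_ lt).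
      by have := xk lt; rewrite ey; lia.
    have := N k'; rewrite eqxx; have -> : k' == k = false by lia.
    move=> e; have := sorted_nth_le so (ltnW l); rewrite sr => /(_ lt').
    by have := xk' lt'; rewrite -ey; lia.
  split; first by have := N k; rewrite -ekk eqxx.
  congr cons => //; apply: (@eq_from_nth _ 0) => // j _; have := N j; rewrite -ekk.
  by case: eqP => // -> _; rewrite ey ekk.
- by case: row_insert.
- by case: row_insert.
- by case=> /rcons_inj [-> ->] ->.
Qed.

(** The invariants that make a step reversible: [m.+1] marks the new cell, and rows without empty
    ones are determined by their [nth] values. *)
Definition RS_good m (UB : tableau * tableau) :=
  [/\ all (sorted leq) UB.1, shape UB.1 = shape UB.2,
      forall i, i < size UB.2 -> nth [::] UB.2 i != [::] &
      forall i, all (fun y => y <= m) (nth [::] UB.2 i)].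

Lemma RS_step_good m UB x : RS_good m UB -> RS_good m.+1 (RS_step UB (x, m.+1)).
Proof.
case: UB => U B [/= sU sh nB bB]; rewrite /RS_step /=.
have := row_insert_sorted x sU; have := row_insert_shape x U; have := row_insert_le x U.
case: (row_insert x U) => U' i /= li shU sU'.
have sUB : size U = size B by have := congr1 size sh; rewrite !size_map.
rewrite sUB in li.
split => //=.
- rewrite shU sh; apply: (@eq_from_nth _ 0).
    by rewrite size_incr_nth !size_map size_set_nth; case: ltnP; lia.
  move=> j; rewrite size_incr_nth !size_map => js.
  have js' : j < maxn i.+1 (size B) by move: js; case: (ltnP i (size B)); lia.
  rewrite nth_incr_nth [RHS](nth_map [::]) ?size_set_nth // nth_set_nth /= eq_sym.
  case: (ltnP j (size B)) => jB.
    rewrite (nth_map [::]) //; case: eqP => [->|_] //=; by rewrite size_rcons.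
  have ej : j = i by lia.
  by rewrite ej eqxx size_rcons nth_default ?size_map -?ej // nth_default.
- move=> j; rewrite size_set_nth nth_set_nth /=.
  by case: (eqVneq j i) => [_ _|nj jm]; [rewrite -size_eq0 size_rcons | apply: nB; lia].
- move=> j; rewrite nth_set_nth /=; case: eqP => [_|_]; last first.
    by apply: sub_all (bB j) => y; lia.
  by rewrite all_rcons leqnn; apply: sub_all (bB i) => y; lia.
Qed.

Lemma RS_step_inj m UB UB' x x' : RS_good m UB -> RS_good m UB' ->
  RS_step UB (x, m.+1) = RS_step UB' (x', m.+1) -> x = x' /\ UB = UB'.
Proof.
case: UB UB' => U B [U' B'] [/= sU sh nB bB] [/= sU' sh' nB' bB']; rewrite /RS_step /=.
have li := row_insert_le x U; have li' := row_insert_le x' U'.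
have sUB : size U = size B by have := congr1 size sh; rewrite !size_map.
have sUB' : size U' = size B' by have := congr1 size sh'; rewrite !size_map.
case E: (row_insert x U) li => [V i] /= li; case E': (row_insert x' U') li' => [V' i'] /= li'.
case=> eV eB.
have N j : (if j == i then rcons (nth [::] B i) m.+1 else nth [::] B j) =
    (if j == i' then rcons (nth [::] B' i') m.+1 else nth [::] B' j).
  by have := congr1 (fun s => nth [::] s j) eB; rewrite !nth_set_nth.
have ei : i = i'.
  apply/eqP; apply/negPn/negP => nii; have := N i; rewrite eqxx (negPf nii) => e.
  by have := bB' i; rewrite -e all_rcons ltnn.
have eBB j : nth [::] B j = nth [::] B' j.
  by have := N j; rewrite -ei; case: eqP => // -> /rcons_inj [].
have eb : B = B'.
  apply: (@eq_from_nth _ [::]) => //; apply/eqP; rewrite eqn_leq; apply/andP; split; rewrite leqNgt; apply/negP => l.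
    by have := nB _ l; rewrite eBB nth_default.
  by have := nB' _ l; rewrite -eBB nth_default.
have [||||-> ->] := @row_insert_inj x x' U U' => //; last by rewrite eb.
  by rewrite sh sh' eb.
by rewrite E E' eV ei.
Qed.

Lemma RS_rcons w x : RS (rcons w x) = RS_step (RS w) (x, (size w).+1).
Proof.
rewrite /RS size_rcons -[(size w).+1 in LHS]addn1 iotaD /= cats1 zip_rcons ?size_iota //.
by rewrite foldl_rcons.
Qed.

Lemma RS_goodP w : RS_good (size w) (RS w).
Proof.
elim/last_ind: w => [|w x IH]; first by split => //= i; rewrite nth_nil.
by rewrite RS_rcons size_rcons; apply: RS_step_good.
Qed.

Lemma RS_inj w w' : size w = size w' -> RS w = RS w' -> w = w'.
Proof.
elim/last_ind: w w' => [|w x IH] w'; first by move/esym/size0nil.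
case/lastP: w' => [|w' x']; first by rewrite size_rcons.
rewrite !size_rcons => -[sz]; rewrite !RS_rcons -sz => e.
have [|-> /(IH _ sz) -> //] := RS_step_inj (RS_goodP w) _ e.
by rewrite sz; apply: RS_goodP.
Qed.

Lemma RS_invP n w PQ : perm_eq w (iota 1 n) -> RS w = PQ -> RS_inv n PQ = w.
Proof.
move=> pw ew; rewrite /RS_inv.
set l := [seq _ <- _ | _].
have wl : w \in l by rewrite mem_filter ew eqxx mem_permutations.
have : head [::] l \in l by case: (l) wl => //= w' l' _; rewrite mem_head.
rewrite {2}/l mem_filter mem_permutations => /andP[/eqP e' p'].
by apply: RS_inj; rewrite ?e' ?ew // (perm_size p') (perm_size pw).
Qed.

(** * Insertion of the promotion word *)

Definition row_length (D : seq cell) i := count (fun x => x.1 == i) D.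

Lemma mem_row_length D i k : valid [::] D -> ((i, k) \in D) = (k < row_length D i).
Proof.
elim/last_ind: D i k => // D x IH i k; rewrite valid_rcons cats0 => /andP[v ax].
rewrite mem_rcons inE /row_length -cats1 count_cat /= addn0 -/(row_length D i) IH //.
case/and3P: ax => nx _ lx; case: x nx lx => a b /=.
rewrite !IH // xpair_eqE; case: (eqVneq a i) => [eai|nai] /= nx lx.
  by subst a; rewrite ?eqxx; lia.
by lia.
Qed.

Lemma SYT_mono R c T i i' k k' : SYT R c T -> i' < i -> k' <= k -> i < R -> k < c ->
  entry T (i', k') < entry T (i, k).
Proof.
move=> st li lk iR kc; apply: (@leq_trans (entry T (i, k'))).
  elim: i li iR => // i IH; rewrite ltnS leq_eqVlt => /orP[/eqP-> iR|li iR].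
    by apply: SYT_down st iR _; lia.
  by apply: ltn_trans (IH li (ltnW iR)) (SYT_down st iR _); lia.
elim: k lk kc => [|k IH]; first by rewrite leqn0 => /eqP->.
rewrite leq_eqVlt => /orP[/eqP->//|lk kc].
by apply: leq_trans (IH lk (ltnW kc)) _; apply/ltnW/(SYT_right st).
Qed.

Section Insertion.

Variables (r c : nat) (P Q : tableau).
Hypothesis hQ : SYT r c Q.

(* When [D] has been filled, the [i]-th column of the insertion tableau consists of the
   last [row_length D i] entries of the [i]-th row of [Q]. *)
Definition ins_row D k := [seq entry Q (i, c - row_length D i + k) | i <- iota 0 (col_height D k)].
Definition ins_tab D := [seq ins_row D k | k <- iota 0 (row_length D 0)].
Definition rec_row D k := [seq entry P (i, k) | i <- iota 0 (col_height D k)].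
Definition rec_tab D := [seq rec_row D k | k <- iota 0 (row_length D 0)].

Section Step.

Variables (D : seq cell) (i k : nat).
Hypotheses (vD : valid [::] D) (ax : addable D (i, k)) (ir : i < r) (kc : k < c).
Hypothesis DR : {in D, forall x, in_rect r c x}.

Let D' := rcons D (i, k).

Let mc a b : ((a, b) \in D) = (a < col_height D b). Proof. exact: mem_col_height. Qed.
Let mr a b : ((a, b) \in D) = (b < row_length D a). Proof. exact: mem_row_length. Qed.

Let ci : col_height D k = i.
Proof. by case/and3P: ax => /=; rewrite !mc; lia. Qed.

Let ri : row_length D i = k.
Proof. by case/and3P: ax => /=; rewrite !mr; lia. Qed.

Let colD' b : col_height D' b = col_height D b + (b == k).
Proof. by rewrite /col_height /D' -cats1 count_cat /= addn0 eq_sym. Qed.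

Let rowD' a : row_length D' a = row_length D a + (a == i).
Proof. by rewrite /row_length /D' -cats1 count_cat /= addn0 eq_sym. Qed.

Let rlow a : a < i -> k < row_length D a.
Proof.
move=> ai; rewrite -mr mc; suff : a < col_height D k by [].
by rewrite ci.
Qed.

Let rle a : row_length D a <= c.
Proof.
rewrite leqNgt; apply/negP; rewrite -mr => /DR; rewrite /in_rect /= ltnn andbF //.
Qed.

Let r0 : row_length D 0 = if i == 0 then k else maxn k.+1 (row_length D 0).
Proof.
case: eqP => [e|ne]; first by rewrite -ri e.
by have := @rlow 0; lia.
Qed.

Let drop_tab (f : nat -> seq nat) t n : t < n ->
  drop t [seq f a | a <- iota 0 n] = f t :: drop t.+1 [seq f a | a <- iota 0 n].
Proof.
by move=> tn; rewrite (drop_nth [::]) ?size_map ?size_iota // (nth_map 0) ?size_iota // nth_iota.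
Qed.

Let rest_eq t : k < t -> drop t (ins_tab D) = drop t (ins_tab D').
Proof.
move=> kt; apply: (@eq_from_nth _ [::]).
  by rewrite !size_drop !size_map !size_iota rowD' r0; case: (eqVneq 0 i); lia.
move=> a; rewrite size_drop size_map size_iota => ta.
rewrite !nth_drop !(nth_map 0) ?size_iota ?rowD'; try lia.
rewrite !nth_iota ?rowD'; try lia.
rewrite /ins_row !add0n colD'; have -> : (t + a == k) = false by lia.
rewrite addn0; apply/eq_in_map => b; rewrite mem_iota add0n /= -mc mr => bt.
rewrite rowD'; case: eqP => [e|_]; last by rewrite addn0.
by move: bt; rewrite e ri; lia.
Qed.

(* The bumping path goes straight down the [i]-th column. *)
Lemma row_insert_ins_tab t : t <= k ->
  row_insert (entry Q (i, c.-1 - k + t)) (drop t (ins_tab D)) = (drop t (ins_tab D'), k - t).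
Proof.
move: {2}(k - t) (erefl (k - t)) => m.
elim: m t => [|m IH] t em tk.
  have et : t = k by lia.
  rewrite et subnn subnK; last lia.
  have eD' : drop k (ins_tab D') = rcons (ins_row D k) (entry Q (i, c.-1)) :: drop k.+1 (ins_tab D').
    rewrite drop_tab; last by rewrite rowD' r0; case: (eqVneq 0 i) => /=; lia.
    congr cons; rewrite /ins_row colD' eqxx ci addn1 -cats1 -[i.+1]addn1 iotaD map_cat /= add0n.
    congr cat; last first.
      (* Row [i] of [D'] has length [k.+1], and [c - k.+1 + k = c.-1]. *)
      by rewrite rowD' ri eqxx; congr [:: entry Q (_, _)]; lia.
    apply/eq_in_map => a; rewrite mem_iota /= => ai; rewrite rowD'.
    by have -> : (a == i) = false by [lia]; rewrite addn0.
  (* For [i = 0] the insertion tableau has no row [k] yet, and the value opens it. *)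
  rewrite eD'; have [i0|ni] := eqVneq i 0.
    have e0 : row_length D 0 = k by rewrite r0 i0.
    rewrite drop_oversize ?size_map ?size_iota ?e0 //= -rest_eq //.
    by rewrite drop_oversize ?size_map ?size_iota ?e0 //= /ins_row ci i0.
  rewrite drop_tab; last by rewrite r0 (negPf ni); lia.
  rewrite /=; set row := ins_row D k.
  have -> : find (fun y => entry Q (i, c.-1) < y) row = size row.
    apply/eqP; rewrite eqn_leq find_size leqNgt -has_find; apply/hasPn => y /mapP[a].
    rewrite mem_iota ci /= => ai ->; rewrite -leqNgt ltnW //.
    by apply: (SYT_mono hQ) => //; have := @rlow a; have := rle a; lia.
  by rewrite ltnn rest_eq.
have tk' : t < k by lia.
have it : i < col_height D t by rewrite -mc mr ri.
have tr0 : t < row_length D 0 by rewrite r0; case: ifP; lia.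
rewrite drop_tab // /=; set row := ins_row D t; set x := entry Q _.
have sr : size row = col_height D t by rewrite size_map size_iota.
have nr a : a < col_height D t -> nth 0 row a = entry Q (a, c - row_length D a + t).
  by move=> at_; rewrite (nth_map 0) ?size_iota // nth_iota.
(* Position [i] holds the right neighbour in [Q] of the inserted entry. Earlier positions hold
   entries of higher rows of [Q], weakly to the left because those rows of [D] are longer than [k],
   hence smaller ones. *)
have -> : find (fun y => x < y) row = i.
  apply: (@find_first _ _ 0); first by rewrite sr.
    rewrite nr // ri; have -> : c - k + t = (c.-1 - k + t).+1 by lia.
    by apply: (SYT_right hQ) => //; lia.
  move=> a ai; rewrite nr; last lia.
  by rewrite -leqNgt ltnW //; apply: (SYT_mono hQ) => //; have := @rlow a; have := rle a; lia.
rewrite sr it nr // ri.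
have -> : c - k + t = c.-1 - k + t.+1 by lia.
rewrite IH; [|lia|lia].
rewrite [RHS](_ : _ = (ins_row D' t :: drop t.+1 (ins_tab D'), k - t)); last first.
  by rewrite drop_tab // rowD'; lia.
congr (_ :: _, _); last lia.
apply: (@eq_from_nth _ 0).
  by rewrite size_set_nth sr (maxn_idPr it) size_map size_iota colD'; lia.
move=> a; rewrite size_set_nth sr (maxn_idPr it) => at_; rewrite nth_set_nth /= nr //.
rewrite (nth_map 0) ?size_iota ?colD'; last lia.
rewrite nth_iota ?colD'; last lia.
rewrite add0n rowD'; case: eqP => [->|_]; last by rewrite addn0.
by rewrite /x ri; congr (entry Q (_, _)); lia.
Qed.

Lemma RS_step_ins_tab : RS_step (ins_tab D, rec_tab D) (entry Q (i, c.-1 - k), entry P (i, k)) =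
  (ins_tab D', rec_tab D').
Proof.
have := row_insert_ins_tab (leq0n k); rewrite addn0 !drop0 subn0 /RS_step /= => ->.
congr pair; apply: (@eq_from_nth _ [::]).
  rewrite size_set_nth !size_map !size_iota rowD' r0; case: (eqVneq i 0) => [e|ne]; lia.
move=> b; rewrite size_set_nth size_map size_iota => bs; rewrite nth_set_nth /=.
have b' : b < row_length D' 0 by move: bs; rewrite rowD' r0; case: (eqVneq i 0) => [e|ne]; lia.
rewrite [RHS](nth_map 0) ?size_iota // nth_iota // add0n /rec_row colD'.
(* Past the last row, the default empty row agrees with [rec_row], as that column of [D] is
   empty. *)
have nB a : nth [::] (rec_tab D) a = rec_row D a.
  have [l|l] := ltnP a (row_length D 0); first by rewrite (nth_map 0) ?size_iota // nth_iota.
  rewrite nth_default ?size_map ?size_iota // /rec_row.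
  suff -> : col_height D a = 0 by [].
  by apply/eqP; rewrite -leqn0 leqNgt -mc mr -leqNgt.
rewrite !nB; case: eqP => [->|_]; last by rewrite addn0.
by rewrite /rec_row ci addn1 -cats1 -[i.+1]addn1 iotaD map_cat.
Qed.

End Step.
End Insertion.

Lemma row_length_full r c p i : full r c p -> i < r -> row_length p i = c.
Proof.
move=> fp ir; have [v _] := andP fp.
have H k := mem_row_length i k v; have := H c; have := H (row_length p i).
by have := H c.-1; rewrite !(full_mem _ fp) /in_rect /= ir; lia.
Qed.

Lemma col_height_full r c p k : full r c p -> k < c -> col_height p k = r.
Proof.
move=> fp kc; have [v _] := andP fp.
have H i := mem_col_height i k v; have := H r; have := H (col_height p k).
by have := H r.-1; rewrite !(full_mem _ fp) /in_rect /= kc; lia.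
Qed.

(** [ins_tab] and [rec_tab] follow the insertion along the prefixes [D] of [p]; once [D] is the
    whole rectangle they are the two transposes. *)
Lemma RS_word r c P Q p : 0 < r -> SYT r c P -> SYT r c Q -> reads r c 1 P p ->
  RS [seq entry Q (x.1, c.-1 - x.2) | x <- p] = (transpose c Q, transpose c P).
Proof.
move=> r0 hP hQ [fp ep]; have sp := full_size_eq fp.
have -> : (transpose c Q, transpose c P) = (ins_tab c Q p, rec_tab P p).
  rewrite /ins_tab /rec_tab (row_length_full fp r0); congr pair; apply/eq_in_map => k.
    rewrite mem_iota /= => kc; rewrite /ins_row (col_height_full fp kc).
    apply: (@eq_from_nth _ 0); first by rewrite !size_map size_iota (SYT_size hQ).
    move=> i; rewrite size_map (SYT_size hQ) => ir.
    rewrite (nth_map [::]) ?(SYT_size hQ) // (nth_map 0) ?size_iota // nth_iota // add0n.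
    by rewrite (row_length_full fp ir) subnn.
  rewrite mem_iota /= => kc; rewrite /rec_row (col_height_full fp kc).
  apply: (@eq_from_nth _ 0); first by rewrite !size_map size_iota (SYT_size hP).
  move=> i; rewrite size_map (SYT_size hP) => ir.
  by rewrite (nth_map [::]) ?(SYT_size hP) // (nth_map 0) ?size_iota // nth_iota.
rewrite /RS size_map sp -ep zip_map.
suff H s D : p = D ++ s ->
    foldl RS_step (ins_tab c Q D, rec_tab P D) [seq (entry Q (x.1, c.-1 - x.2), entry P x) | x <- s] =
    (ins_tab c Q p, rec_tab P p) by apply: (H p [::]).
elim: s D => [|[i k] s IH] D e; first by rewrite e cats0.
have [v _] := andP fp; have pR x : x \in p -> in_rect r c x by rewrite (full_mem _ fp).
have [vD ax] : valid [::] D /\ addable D (i, k).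
  by move: v; rewrite e valid_cat cats0 => /andP[-> /= /andP[-> _]].
have /andP[/= ir kc] : in_rect r c (i, k) by apply: pR; rewrite e mem_cat mem_head orbT.
rewrite (RS_step_ins_tab P hQ vD ax ir kc) ?IH ?cat_rcons //.
by move=> x xD; apply: pR; rewrite e mem_cat xD.
Qed.

Theorem theorem1p1 (r c : nat) (hr : 1 <= r) (hc : 1 <= c) (P Q : tableau)
    (hP : SYT r c P) (hQ : SYT r c Q) :
  let n := r * c in
  let S := stack n P Q in
  let w := [seq x - n | x <- take n (prom (2 * r) c r S)] in
  perm_eq w (iota 1 n) /\ w = RS_inv n (transpose c Q, transpose c P).
Proof.
have [p rp] := SYT_reads hP; have [q rq] := SYT_reads hQ.
move=> n S w; rewrite /w /S /n (prom_stack hr hP hQ rp rq) {w S n}.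
(* Reflecting the columns permutes the cells of the rectangle, so the word rearranges the entries of
   [Q]. *)
have pw : perm_eq [seq entry Q (x.1, c.-1 - x.2) | x <- p] (iota 1 (r * c)).
  case/and4P: (hQ) => _ _ _; rewrite -(map_entry_rect_cells hQ); apply: perm_trans.
  rewrite (map_comp (entry Q) (fun x : cell => (x.1, c.-1 - x.2))).
  have [fp _] := rp; have [v _] := andP fp.
  have fi : {in p &, injective (fun x : cell => (x.1, c.-1 - x.2))}.
    move=> [a b] [a' b']; rewrite !(full_mem _ fp) => /andP[/= _ l] /andP[/= _ l'] [-> e].
    by congr pair; lia.
  apply/perm_map/uniq_perm; rewrite ?rect_cells_uniq ?(map_inj_in_uniq fi) ?(valid0_uniq v) //.
  move=> [a b]; rewrite mem_rect_cells /in_rect /=; apply/mapP/idP => [[[a' b']]|/andP[ar bc]].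
    by rewrite (full_mem _ fp) => /andP[/= ? ?] [-> ->]; lia.
  exists (a, c.-1 - b); first by rewrite (full_mem _ fp) /in_rect /= ar; lia.
  by congr pair => /=; lia.
by split => //; rewrite (RS_invP pw (RS_word hr hP hQ rp)).
Qed.
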